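(* Under the FIDE Laws of Chess effective from 1 January 2023, every legal move sequence from the standard initial position, continued until the first mandatory termination condition applies, has length at most $17{,}697$ plies. This bound is attained, i.e. there exists such a move sequence of length exactly $17{,}697$ plies.
   Context: Legal moves are those of standard chess from the standard initial position (including the initial two-rank pawn advance, en passant, compulsory promotion to a queen, rook, bishop or knight of the pawn's own colour as part of the move reaching the last rank, and castling, which counts as one move). One ply is one move by one player; White moves first, so White plays the odd-numbered plies and the players alternate. The length of a move sequence is its number of plies. Mandatory termination conditions (the sequence ends as soon as the first of them applies): (1) Checkmate (the player to move has no legal move and that player's king is under attack), stalemate (the player to move has no legal move and that player's king is not under attack), or a dead position (a position from which neither player can checkmate by any possible sequence of legal moves). (2) Fivefold repetition: the same position has appeared at least five times. Two positions are the same if and only if the same player has the move, pieces of the same kind and colour occupy the same squares, and the possible moves of all pieces of both players are the same; in particular, a change in the availability of a legal en passant capture or in castling rights makes positions different. (3) Seventy-five-move rule: 75 consecutive moves by each player, equivalently 150 consecutive plies, have been made without a pawn move or a capture; if the final ply delivers checkmate, checkmate takes precedence. Time forfeiture, resignation, draws by agreement, and claimable draws (e.g. claims of threefold repetition or under the fifty-move rule) are disregarded. *)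

(* Defs.v *)
From HB Require Import structures.
From mathcomp Require Import all_boot.

Set Implicit Arguments.
Unset Strict Implicit.
Unset Printing Implicit Defensive.

(* Standard chess, played under the FIDE Laws of Chess of 1 January 2023,      *)
(* restricted to the mandatory ways of ending a game on the board.             *)

Inductive color := White | Black.
Inductive side := KingSide | QueenSide.
Inductive kind := Pawn | Knight | Bishop | Rook | Queen | King.

Definition bool_of_color c := if c is White then true else false.
Definition color_of_bool b := if b then White else Black.
Lemma bool_of_colorK : cancel bool_of_color color_of_bool.
Proof. by case. Qed.
HB.instance Definition _ := Finite.copy color (can_type bool_of_colorK).

Definition bool_of_side d := if d is KingSide then true else false.
Definition side_of_bool b := if b then KingSide else QueenSide.
Lemma bool_of_sideK : cancel bool_of_side side_of_bool.
Proof. by case. Qed.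
HB.instance Definition _ := Finite.copy side (can_type bool_of_sideK).

Definition ord_of_kind k : 'I_6 :=
  match k with
  | Pawn => @Ordinal 6 0 isT | Knight => @Ordinal 6 1 isT
  | Bishop => @Ordinal 6 2 isT | Rook => @Ordinal 6 3 isT
  | Queen => @Ordinal 6 4 isT | King => @Ordinal 6 5 isT
  end.
Definition kind_of_ord (i : 'I_6) :=
  nth King [:: Pawn; Knight; Bishop; Rook; Queen; King] i.
Lemma ord_of_kindK : cancel ord_of_kind kind_of_ord.
Proof. by case. Qed.
HB.instance Definition _ := Finite.copy kind (can_type ord_of_kindK).

Definition opp c := if c is White then Black else White.

(* A square is a pair (file, rank): a1 is (0, 0) and h8 is (7, 7). *)
Notation square := ('I_8 * 'I_8)%type.
Notation piece := (color * kind)%type.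
Notation board_type := {ffun 'I_8 * 'I_8 -> option (color * kind)}.

Definition file_a : 'I_8 := @Ordinal 8 0 isT.
Definition file_c : 'I_8 := @Ordinal 8 2 isT.
Definition file_d : 'I_8 := @Ordinal 8 3 isT.
Definition file_e : 'I_8 := @Ordinal 8 4 isT.
Definition file_f : 'I_8 := @Ordinal 8 5 isT.
Definition file_g : 'I_8 := @Ordinal 8 6 isT.
Definition file_h : 'I_8 := @Ordinal 8 7 isT.

Definition home_rank c : 'I_8 := if c is White then ord0 else ord_max.
Definition king_home c : square := (file_e, home_rank c).
Definition king_castled c d : square :=
  (if d is KingSide then file_g else file_c, home_rank c).
Definition rook_home c d : square :=
  (if d is KingSide then file_h else file_a, home_rank c).
Definition rook_castled c d : square :=
  (if d is KingSide then file_f else file_d, home_rank c).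

(* A move (s, t, q) takes the piece on s to t; q is the kind a promoting pawn  *)
(* becomes. Castling is the two-square move of the king.                       *)
Notation move := ('I_8 * 'I_8 * ('I_8 * 'I_8) * option kind)%type.
Definition src (m : move) : square := m.1.1.
Definition dst (m : move) : square := m.1.2.
Definition promotion (m : move) : option kind := m.2.

Record position := Position {
  turn : color;
  board : board_type;
  castling : {set color * side};
  (* where the pawn stands that advanced two ranks on the last ply, if any *)
  double_step : option square
}.

Definition back_rank :=
  [:: Rook; Knight; Bishop; Queen; King; Bishop; Knight; Rook].

Definition initial : position := {|
  turn := White;
  board := [ffun s : square =>
    match val s.2 with
    | 0 => Some (White, nth Rook back_rank s.1)
    | 1 => Some (White, Pawn)
    | 6 => Some (Black, Pawn)
    | 7 => Some (Black, nth Rook back_rank s.1)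
    | _ => None
    end];
  castling := setT;
  double_step := None
|}.

Definition dist (i j : nat) := (i - j) + (j - i).
Definition dfile (s t : square) := dist s.1 t.1.
Definition drank (s t : square) := dist s.2 t.2.

Definition ahead c n (s t : square) : bool :=
  if c is White then t.2 == s.2 + n :> nat else s.2 == t.2 + n :> nat.

Definition orthogonal (s t : square) :=
  (s != t) && ((dfile s t == 0) || (drank s t == 0)).
Definition diagonal (s t : square) := (s != t) && (dfile s t == drank s t).

(* u lies strictly between s and t on the straight segment joining them; the   *)
(* last clause is collinearity, the two before it place u between s and t.     *)
Definition strictly_between (s u t : square) :=
  [&& u != s, u != t,
      dfile s u + dfile u t == dfile s t,
      drank s u + drank u t == drank s t &
      dfile s u * drank s t == drank s u * dfile s t].

Definition clear (b : board_type) (s t : square) :=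
  [forall u : square, strictly_between s u t ==> (b u == None)].

Definition pawn_attack c (s t : square) := ahead c 1 s t && (dfile s t == 1).

Definition attacks (b : board_type) (pc : piece) (s t : square) : bool :=
  match pc.2 with
  | Pawn => pawn_attack pc.1 s t
  | Knight => (dfile s t == 1) && (drank s t == 2) ||
              (dfile s t == 2) && (drank s t == 1)
  | Bishop => diagonal s t && clear b s t
  | Rook => orthogonal s t && clear b s t
  | Queen => (diagonal s t || orthogonal s t) && clear b s t
  | King => maxn (dfile s t) (drank s t) == 1
  end.

Definition attacked (b : board_type) c (t : square) :=
  [exists s : square, exists k : kind,
     (b s == Some (c, k)) && attacks b (c, k) s t].

Definition in_check (b : board_type) c :=
  [exists s : square, (b s == Some (c, King)) && attacked b (opp c) s].

Definition holds_color (b : board_type) c (s : square) :=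
  if b s is Some pc then pc.1 == c else false.

(* The captured pawn stands on the file of arrival and the rank of departure. *)
Definition en_passant p c (s t : square) :=
  [&& board p s == Some (c, Pawn), pawn_attack c s t,
      double_step p == Some (t.1, s.2) &
      board p (t.1, s.2) == Some (opp c, Pawn)].

Definition pawn_move p c (s t : square) :=
  [|| [&& dfile s t == 0, ahead c 1 s t & board p t == None],
      [&& dfile s t == 0, ahead c 2 s t, ahead c 1 (s.1, home_rank c) s,
          board p t == None & clear (board p) s t],
      pawn_attack c s t && holds_color (board p) (opp c) t |
      en_passant p c s t].

Definition castles p c d (s t : square) :=
  [&& s == king_home c, t == king_castled c d,
      board p s == Some (c, King),
      board p (rook_home c d) == Some (c, Rook),
      (c, d) \in castling p,
      clear (board p) s (rook_home c d) &
      [forall u : square, [|| u == s, strictly_between s u t | u == t] ==>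
         ~~ attacked (board p) (opp c) u]].

Definition promotion_ok c k (m : move) :=
  if (k == Pawn) && ((dst m).2 == home_rank (opp c))
  then promotion m \in [:: Some Queen; Some Rook; Some Bishop; Some Knight]
  else promotion m == None.

(* The moves of player c in p, up to the safety of c's own king. *)
Definition pseudo_legal p c (m : move) :=
  let s := src m in let t := dst m in
  if board p s is Some (c', k) then
    [&& c' == c, ~~ holds_color (board p) c t,
        board p t != Some (opp c, King), promotion_ok c k m &
        match k with
        | Pawn => pawn_move p c s t
        | King => attacks (board p) (c, King) s t ||
                  [exists d : side, castles p c d s t]
        | _ => attacks (board p) (c, k) s t
        end]
  else false.

Definition put (b : board_type) (s : square) (x : option piece) : board_type :=
  [ffun u => if u == s then x else b u].

Definition moved_board p c k (m : move) : board_type :=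
  let s := src m in let t := dst m in
  let b := put (put (board p) s None) t (Some (c, odflt k (promotion m))) in
  if en_passant p c s t then put b (t.1, s.2) None
  else if (k == King) && (s == king_home c) then
    if t == king_castled c KingSide then
      put (put b (rook_home c KingSide) None)
          (rook_castled c KingSide) (Some (c, Rook))
    else if t == king_castled c QueenSide then
      put (put b (rook_home c QueenSide) None)
          (rook_castled c QueenSide) (Some (c, Rook))
    else b
  else b.

(* A right to castle is lost as soon as a move starts or ends on the original  *)
(* square of the king or of the rook concerned.                                *)
Definition make p (m : move) : position :=
  if board p (src m) is Some (c, k) then
    {| turn := opp c;
       board := moved_board p c k m;
       castling := [set cd in castling p |
         (king_home cd.1 \notin [:: src m; dst m]) &&
         (rook_home cd.1 cd.2 \notin [:: src m; dst m])];
       double_step :=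
         if (k == Pawn) && (drank (src m) (dst m) == 2)
         then Some (dst m) else None |}
  else p.

Definition possible p c (m : move) :=
  pseudo_legal p c m && ~~ in_check (board (make p m)) c.

Definition legal p (m : move) := possible p (turn p) m.

Fixpoint legal_line p (ms : seq move) : bool :=
  if ms is m :: ms' then legal p m && legal_line (make p m) ms' else true.

Definition play p (ms : seq move) : position := foldl make p ms.

Definition no_legal_move p := [forall m : move, ~~ legal p m].
Definition checkmate p := no_legal_move p && in_check (board p) (turn p).
Definition stalemate p := no_legal_move p && ~~ in_check (board p) (turn p).
Definition dead p :=
  ~ exists ms : seq move, legal_line p ms /\ checkmate (play p ms).

(* The moves of both players are compared, each as if it were to move. *)
Definition same_position p q :=
  [&& turn p == turn q, board p == board q, castling p == castling q &
      [forall c : color, forall m : move, possible p c m == possible q c m]].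

Definition history (ms : seq move) : seq position :=
  initial :: scanl make initial ms.

Definition fivefold_repetition (ms : seq move) :=
  has (fun p => 5 <= count (same_position p) (history ms)) (history ms).

Definition quiet p (m : move) :=
  [forall c : color, board p (src m) != Some (c, Pawn)] &&
  (board p (dst m) == None).

Fixpoint quiet_line p (ms : seq move) : bool :=
  if ms is m :: ms' then quiet p m && quiet_line (make p m) ms' else true.

Definition seventy_five_moves (ms : seq move) :=
  exists ms1 ms2 ms3 : seq move,
    [/\ ms = ms1 ++ ms2 ++ ms3, size ms2 = 150 &
        quiet_line (play initial ms1) ms2].

Definition terminated (ms : seq move) : Prop :=
  [\/ [\/ checkmate (play initial ms), stalemate (play initial ms) |
          dead (play initial ms)],
      fivefold_repetition ms | seventy_five_moves ms].

(* A legal sequence of plies none of which is played after a mandatory        *)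
(* termination condition applies; it need not have reached one.               *)
Definition game (ms : seq move) : Prop :=
  legal_line initial ms /\
  forall n, n < size ms -> ~ terminated (take n ms).

Definition complete_game (ms : seq move) : Prop := game ms /\ terminated ms.

(* Main.v *)
Require Import Defs.
From Stdlib Require Import Ascii String.
From mathcomp Require Import all_boot.
From mathcomp Require Import zify.

Set Implicit Arguments.
Unset Strict Implicit.
Unset Printing Implicit Defensive.

(** Call a ply an event if it moves a pawn or captures. A game stops after 150
    plies without event, so it is long when it has many events, each as late as
    possible: 149 plies after the previous event if the same player makes both,
    but only 148 if the players differ, for reasons of parity. Counting the
    start of the game as an event of Black, a game with z events, s changes of
    the player who makes them and k plies after the last event has at most
    150 z - s + k plies ([time_bound]).

    At most 118 events. There are at most 96 pawn moves and 30 captures, and a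
    pawn that captures does both at once. Two opposing pawns of one file that
    never capture cannot pass one another, so one of them is captured early and
    they make at most 10 of their 12 moves. Every file thus costs at least one
    event ([file_steps_takes]), which leaves 126 - 8. With 118 events only the
    kings remain, and the position is dead at once ([dead_at_118]).

    At most 116 events if there are at most two changes ([events_few_switches]).
    The events then come as a block of Black, a block of White and a block of
    Black. While no white pawn has moved, a black pawn enters the second rank
    only by capturing an unmoved white pawn, which costs six moves. Otherwise
    each black pawn still has two moves to make when White begins. Either White
    captures it in its block and these are lost, or it is never captured, for
    White makes no later event. So the black pawns cost eight events besides the
    captures by pawns; and with at most one capture by a pawn the files on which
    no pawn captures cost more than that.

    Hence a longest game has three changes, and at most 117 events followed by
    150 plies or 118 events followed by none: 150 * 118 - 3 = 17697 plies.

    For the converse a game of that length is written down. Its 117 events are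
    the blocks [opening_captures], [white_pawns], [black_pawns_and_captures] and
    [white_captures]. In between, each side repeats a short cycle of moves; the
    lengths of the two cycles are such that no position returns a fifth time.
    The game is checked by computation on a concrete board; the remaining point,
    that no position on the way is dead, follows from one short line to mate
    from the last position but one ([mating_line]). *)

(** * What a legal move does to the board *)

Lemma legal_line_cat p ms1 ms2 :
  legal_line p (ms1 ++ ms2) = legal_line p ms1 && legal_line (play p ms1) ms2.
Proof. by elim: ms1 p => //= m ms1 IH p; rewrite IH andbA. Qed.

Lemma quiet_line_cat p ms1 ms2 :
  quiet_line p (ms1 ++ ms2) = quiet_line p ms1 && quiet_line (play p ms1) ms2.
Proof. by elim: ms1 p => //= m ms1 IH p; rewrite IH andbA. Qed.

Lemma quietE p m :
  quiet p m = (if board p (src m) is Some (_, Pawn) then false else true) &&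
              (board p (dst m) == None).
Proof.
rewrite /quiet; congr (_ && _).
case: (board p (src m)) => [[c k]|]; last by apply/forallP.
have -> : [forall c', Some (c, k) != Some (c', Pawn)] = (k != Pawn).
  apply/forallP/idP => [/(_ c)|k_pawn c']; first by apply: contra => /eqP->.
  by apply: contra k_pawn => /eqP[_ ->].
by case: k.
Qed.

Lemma eq_opp c c' : (c == opp c') = (c != c').
Proof. by case: c c' => [] []. Qed.

Lemma opp_eqF c : (opp c == c) = false.
Proof. by case: c. Qed.

Definition coloured c (x : option piece) :=
  if x is Some pc then pc.1 == c else false.

Definition men (b : board_type) c := #|[set s | holds_color b c s]|.

Lemma putE b s x u : put b s x u = if u == s then x else b u.
Proof. by rewrite ffunE. Qed.

Lemma holds_put b s x c u :
  holds_color (put b s x) c u =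
  if u == s then coloured c x else holds_color b c u.
Proof. by rewrite /holds_color putE; case: eqP. Qed.

Lemma men_put b s x c :
  men (put b s x) c + holds_color b c s = men b c + coloured c x.
Proof.
rewrite /men (cardsD1 s) [in RHS](cardsD1 s) !inE holds_put eqxx.
rewrite (eq_card (B := [set u | holds_color b c u] :\ s)); first by lia.
by move=> u; rewrite !inE holds_put; case: (u == s).
Qed.

Definition arrival p (m : move) k : option piece :=
  Some (turn p, odflt k (promotion m)).

(** The three shapes of a legal move, with what legality says about the squares
    that change. *)
Variant effect p (m : move) : board_type -> Prop :=
| Plain k of board p (src m) = Some (turn p, k)
    & ~~ en_passant p (turn p) (src m) (dst m) :
    effect p m (put (put (board p) (src m) None) (dst m) (arrival p m k))
| EnPassant of board p (src m) = Some (turn p, Pawn)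
    & en_passant p (turn p) (src m) (dst m) :
    effect p m
      (put (put (put (board p) (src m) None) (dst m) (arrival p m Pawn))
         ((dst m).1, (src m).2) None)
| Castling d of src m = king_home (turn p) & dst m = king_castled (turn p) d
    & board p (src m) = Some (turn p, King)
    & ~~ en_passant p (turn p) (src m) (dst m)
    & promotion m = None
    & board p (rook_home (turn p) d) = Some (turn p, Rook)
    & board p (rook_castled (turn p) d) = None
    & board p (dst m) = None :
    effect p m
      (put (put (put (put (board p) (src m) None)
                   (dst m) (Some (turn p, King)))
              (rook_home (turn p) d) None)
         (rook_castled (turn p) d) (Some (turn p, Rook))).

Lemma legal_effect p m : legal p m -> effect p m (board (make p m)).
Proof.
case/andP; rewrite /pseudo_legal /make.
case bs: (board p (src m)) => [[c k]|] // /and5P[/eqP ec _ _ ok_q ok_m] _ /=.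
rewrite {c}ec in bs ok_q ok_m *; rewrite /moved_board.
case: ifPn => [ep|not_ep].
  have kP : k = Pawn by case/andP: (ep); rewrite bs => /eqP[].
  by rewrite kP in bs *; apply: EnPassant.
case: ifP => [/andP[/eqP kK /eqP s_home]|_]; last exact: Plain.
rewrite {k}kK in bs ok_q ok_m *.
have [d t_d|no_castle] := pickP (fun d => dst m == king_castled (turn p) d);
  last by rewrite !no_castle; apply: Plain.
have {}ok_m : castles p (turn p) d (src m) (dst m).
  case/orP: ok_m => [|/existsP[d' ok_m]].
    by rewrite /attacks /= (eqP t_d) s_home; case: (turn p) d {t_d} => [] [].
  suff -> : d = d' by [].
  case/and3P: ok_m => _ t_d' _; move: t_d; rewrite (eqP t_d').
  by case: (turn p) d d' {t_d'} => [] [] [].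
have q_none : promotion m = None by apply/eqP.
case/and5P: ok_m => _ _ _ /eqP b_rook /and3P[_ /forallP clear_sr _].
have empty u : strictly_between (king_home (turn p)) u (rook_home (turn p) d) ->
    board p u = None.
  by rewrite -s_home => /(implyP (clear_sr u))/eqP.
have := Castling s_home (eqP t_d) bs not_ep q_none b_rook.
rewrite (eqP t_d) q_none /=.
case: d {t_d b_rook clear_sr} empty => empty; rewrite ?eqxx; apply;
  by apply: empty; case: (turn p).
Qed.

Lemma legal_dst p m : legal p m ->
  board p (dst m) = None \/
  exists2 k, board p (dst m) = Some (opp (turn p), k) & k != King.
Proof.
case/andP; rewrite /pseudo_legal; case: (board p (src m)) => [[c k]|] //.
case/and5P=> _ not_own not_king _ _ _.
move: not_own not_king; rewrite /holds_color.
case: (board p (dst m)) => [[c' k']|]; [rewrite -eq_opp|by left].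
move=> /= /eqP-> not_king; right; exists k' => //.
by apply: contra not_king => /eqP->.
Qed.

Lemma dst_not_own p m : legal p m ->
  holds_color (board p) (turn p) (dst m) = false.
Proof.
by move=> /legal_dst; rewrite /holds_color => -[|[k]] -> //=; rewrite opp_eqF.
Qed.

Lemma dst_neq_src p m k : legal p m -> board p (src m) = Some (turn p, k) ->
  (dst m == src m) = false.
Proof.
move=> lm bs; apply/eqP => e; have := dst_not_own lm.
by rewrite /holds_color e bs /= eqxx.
Qed.

Lemma turn_make p m : legal p m -> turn (make p m) = opp (turn p).
Proof.
case/andP; rewrite /pseudo_legal /make.
by case: (board p (src m)) => [[c k]|] // /and5P[/eqP->].
Qed.

Lemma mover_color p m c k : legal p m ->
  board p (src m) = Some (c, k) -> c = turn p.
Proof.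
by case/andP; rewrite /pseudo_legal => + _ bs; rewrite bs => /and5P[/eqP->].
Qed.

Lemma legal_promotion_ok p m k : legal p m ->
  board p (src m) = Some (turn p, k) -> promotion_ok (turn p) k m.
Proof. by case/andP; rewrite /pseudo_legal => + _ bs; rewrite bs => /and5P[]. Qed.

Lemma legal_not_in_check p m : legal p m ->
  ~~ in_check (board (make p m)) (opp (turn (make p m))).
Proof. by move=> lm; rewrite turn_make //; case/andP: lm => _; case: (turn p). Qed.

Definition capturing p (m : move) :=
  (board p (dst m) != None) || en_passant p (turn p) (src m) (dst m).

(** Both squares count for an en passant capture. That the square of arrival is
    empty then is a fact about the previous ply, which this avoids. *)
Definition taken p (m : move) (u : square) :=
  (u == dst m) ||
  en_passant p (turn p) (src m) (dst m) && (u == ((dst m).1, (src m).2)).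

Lemma quiet_not_capturing p m : quiet p m -> ~~ capturing p m.
Proof.
rewrite quietE /capturing /en_passant => /andP[bs ->] /=.
by case: eqP bs => // ->.
Qed.

Lemma en_passant_square p c (s t : square) : en_passant p c s t ->
  [/\ (t.1, s.2) == s = false, (t.1, s.2) == t = false &
      board p (t.1, s.2) = Some (opp c, Pawn)].
Proof.
case/and4P=> _ /andP[ahead1 file1] _ /eqP->; split=> //.
  by apply/eqP => e; move: file1; rewrite /dfile -e /dist subnn.
by apply/eqP => e; move: ahead1; rewrite /ahead -e /=; case: c; lia.
Qed.

Lemma taken_color p m u c k : legal p m -> taken p m u ->
  board p u = Some (c, k) -> turn p = opp c.
Proof.
move=> lm /orP[/eqP->|/andP[/en_passant_square[_ _ eb] /eqP->]] bu.
  by case: (legal_dst lm) => [|[k']]; rewrite bu // => -[-> _] _; case: (turn p).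
by move: bu; rewrite eb => -[<- _]; case: (turn p).
Qed.

Lemma men_castled (b : board_type) c d c' :
  b (king_home c) = Some (c, King) -> b (rook_home c d) = Some (c, Rook) ->
  b (rook_castled c d) = None -> b (king_castled c d) = None ->
  men (put (put (put (put b (king_home c) None)
                   (king_castled c d) (Some (c, King)))
              (rook_home c d) None)
         (rook_castled c d) (Some (c, Rook))) c' = men b c'.
Proof.
move=> bk br bc bt; set k := king_home c; set t := king_castled c d.
set r := rook_home c d; set r' := rook_castled c d.
have := men_put b k None c'.
have := men_put (put b k None) t (Some (c, King)) c'.
have := men_put (put (put b k None) t (Some (c, King))) r None c'.
have := men_put (put (put (put b k None) t (Some (c, King))) r None) r'
          (Some (c, Rook)) c'.
have [e1 e2 e3] : [/\ t == k = false, r == k = false & r == t = false].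
  by rewrite /t /k /r; case: (c) (d) => [] [].
have [e4 e5 e6] : [/\ r' == k = false, r' == t = false & r' == r = false].
  by rewrite /t /k /r /r'; case: (c) (d) => [] [].
by rewrite !holds_put e1 e2 e3 e4 e5 e6 /holds_color bk br bc bt /=; lia.
Qed.

Lemma men_mover p m : legal p m ->
  men (board (make p m)) (turn p) = men (board p) (turn p).
Proof.
move=> lm; have bt := dst_not_own lm.
case: (legal_effect lm) => [k bs _|bs ep|d es et bs _ _ br bc bd].
- have := men_put (board p) (src m) None (turn p).
  have := men_put (put (board p) (src m) None) (dst m) (arrival p m k) (turn p).
  by rewrite holds_put (dst_neq_src lm bs) bt /holds_color bs /= eqxx; lia.
- have [e1 e2 eb] := en_passant_square ep; set b := put _ (dst m) _.
  have := men_put (board p) (src m) None (turn p).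
  have := men_put (put (board p) (src m) None) (dst m) (arrival p m Pawn)
            (turn p).
  have := men_put b ((dst m).1, (src m).2) None (turn p).
  rewrite /b !holds_put e1 e2 (dst_neq_src lm bs) bt /holds_color bs eb /=.
  by rewrite eqxx opp_eqF; lia.
- by rewrite es in bs *; rewrite et in bd *; apply: men_castled.
Qed.

Lemma men_other p m : legal p m ->
  men (board (make p m)) (opp (turn p)) + capturing p m <=
  men (board p) (opp (turn p)).
Proof.
move=> lm; rewrite /capturing.
have bt : holds_color (board p) (opp (turn p)) (dst m) = (board p (dst m) != None).
  by rewrite /holds_color; case: (legal_dst lm) => [|[k]] -> //=; rewrite eqxx.
have fc : turn p == opp (turn p) = false by case: (turn p).
case: (legal_effect lm) => [k bs nep|bs ep|d es et bs nep _ br bc bd].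
- have := men_put (board p) (src m) None (opp (turn p)).
  have := men_put (put (board p) (src m) None) (dst m) (arrival p m k)
            (opp (turn p)).
  rewrite holds_put (dst_neq_src lm bs) bt (negPf nep) orbF.
  by rewrite /holds_color bs /= fc; lia.
- have [e1 e2 eb] := en_passant_square ep; set b := put _ (dst m) _.
  have := men_put (board p) (src m) None (opp (turn p)).
  have := men_put (put (board p) (src m) None) (dst m) (arrival p m Pawn)
            (opp (turn p)).
  have := men_put b ((dst m).1, (src m).2) None (opp (turn p)).
  rewrite /b !holds_put e1 e2 (dst_neq_src lm bs) bt ep orbT.
  by rewrite /holds_color bs eb /= eqxx fc; lia.
- rewrite bd (negPf nep) addn0.
  by rewrite es in bs *; rewrite et in bd *; rewrite men_castled.
Qed.

Lemma men_not_capturing p m c : legal p m -> ~~ capturing p m ->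
  men (board (make p m)) c = men (board p) c.
Proof.
move=> lm; have [->|] := eqVneq c (turn p); first by rewrite men_mover.
rewrite -eq_opp => /eqP->; rewrite /capturing negb_or negbK.
case/andP=> /eqP bt nep.
have fc : turn p == opp (turn p) = false by case: (turn p).
case: (legal_effect lm) => [k bs _|bs ep|d es et bs _ _ br bc bd].
- have := men_put (board p) (src m) None (opp (turn p)).
  have := men_put (put (board p) (src m) None) (dst m) (arrival p m k)
            (opp (turn p)).
  rewrite holds_put (dst_neq_src lm bs) /holds_color bt bs /= fc.
  by lia.
- by rewrite ep in nep.
- by rewrite es in bs *; rewrite et in bd *; apply: men_castled.
Qed.

Lemma pawn_after p m u c : legal p m ->
  (board (make p m) u == Some (c, Pawn)) =
  if u == dst m
  then (board p (src m) == Some (c, Pawn)) && (promotion m == None)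
  else [&& u != src m, ~~ taken p m u & board p u == Some (c, Pawn)].
Proof.
move=> lm; have arrivalE k : board p (src m) = Some (turn p, k) ->
    (arrival p m k == Some (c, Pawn)) =
    (board p (src m) == Some (c, Pawn)) && (promotion m == None).
  move=> bs; move: (legal_promotion_ok lm bs); rewrite bs /promotion_ok /arrival.
  case: ifP => [/andP[/eqP-> _]|_ /eqP->]; last by rewrite eqxx andbT.
  by rewrite !inE => /or4P[] /eqP-> /=; rewrite ?andbF; apply/eqP => -[].
rewrite /taken.
case: (legal_effect lm) => [k bs nep|bs ep|d es et bs nep q_none br bc bd].
- rewrite !putE (negPf nep) orbF -(arrivalE k) //.
  by case: (u == dst m); case: (u == src m).
- have [e1 e2 eb] := en_passant_square ep; rewrite !putE ep -(arrivalE Pawn) //=.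
  case: (u =P dst m) => [->|_]; first by rewrite [_ == (_, _)]eq_sym e2.
  by case: (u == (_, _)); case: (u == src m).
- rewrite !putE (negPf nep) orbF q_none bs.
  have [e1 e2] : rook_home (turn p) d == dst m = false /\
                 rook_castled (turn p) d == dst m = false.
    by rewrite et; case: (turn p) (d) => [] [].
  case: (u =P rook_castled _ _) => [->|_].
    by rewrite e2 bc !andbF; apply/eqP => -[].
  case: (u =P rook_home _ _) => [->|_].
    rewrite e1 br.
    have -> : (Some (turn p, Rook) == Some (c, Pawn)) = false by apply/eqP => -[].
    by rewrite !andbF.
  case: (u =P dst m) => [_|_]; first by rewrite andbC; apply/eqP/eqP => -[].
  by case: (u =P src m).
Qed.

Definition has_king (b : board_type) c := [exists s, b s == Some (c, King)].

Lemma has_king_after p m c : legal p m ->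
  has_king (board p) c -> has_king (board (make p m)) c.
Proof.
move=> lm /existsP[u /eqP bu].
have u_dst : u == dst m = false.
  by apply/eqP => e; case: (legal_dst lm) => [|[k]]; rewrite -e bu // => -[_ <-].
case: (legal_effect lm) => [k bs nep|bs ep|d es et bs nep q_none br bc bd].
- case: (u =P src m) => [eu|/eqP/negPf us]; apply/existsP.
    exists (dst m); rewrite putE eqxx /arrival.
    move: (legal_promotion_ok lm bs); rewrite -eu bu in bs.
    by case: bs => -> <- /eqP->.
  by exists u; rewrite !putE u_dst us bu.
- apply/existsP; exists u; have [_ _ eb] := en_passant_square ep.
  rewrite !putE u_dst.
  case: (u =P (_, _)) => [eu|_]; first by rewrite -eu bu in eb.
  by case: (u =P src m) => [eu|_]; [rewrite -eu bu in bs|rewrite bu].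
- apply/existsP; case: (u =P src m) => [eu|/eqP/negPf us].
    exists (dst m); rewrite !putE eqxx et; move: bs; rewrite -eu bu => -[->].
    by case: (turn p) d {br bc et} => [] [].
  exists u; rewrite !putE u_dst us.
  case: (u =P rook_castled _ _) => [eu|_]; first by rewrite -eu bu in bc.
  by case: (u =P rook_home _ _) => [eu|_]; [rewrite -eu bu in br|rewrite bu].
Qed.

(** * The life of a pawn *)

Definition advance c (u : square) : nat := if c is White then u.2 else 7 - u.2.

Lemma pawn_move_legal p m : legal p m ->
  board p (src m) = Some (turn p, Pawn) ->
  pawn_move p (turn p) (src m) (dst m).
Proof. by case/andP; rewrite /pseudo_legal => + _ bs; rewrite bs => /and5P[]. Qed.

Lemma pawn_reach p m : legal p m -> board p (src m) = Some (turn p, Pawn) ->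
  advance (turn p) (dst m) = (advance (turn p) (src m)).+1 \/
  advance (turn p) (src m) = 1 /\ advance (turn p) (dst m) = 3.
Proof.
move=> lm bs; have := pawn_move_legal lm bs.
have := ltn_ord (src m).2; have := ltn_ord (dst m).2; rewrite /advance => t2 s2.
case/or4P => [/and3P[_ a _]|/and5P[_ a h _ _]|/andP[/andP[a _] _]|].
- by left; move: a; rewrite /ahead; case: (turn p); lia.
- by right; move: a h; rewrite /ahead /home_rank; case: (turn p) => /=; lia.
- by left; move: a; rewrite /ahead; case: (turn p); lia.
- case/and4P=> _ /andP[a _] _ _; left; move: a; rewrite /ahead.
  by case: (turn p); lia.
Qed.

Lemma pawn_advances p m : legal p m -> board p (src m) = Some (turn p, Pawn) ->
  advance (turn p) (src m) < advance (turn p) (dst m).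
Proof. by move=> lm bs; case: (pawn_reach lm bs) => [->|[-> ->]]. Qed.

Lemma pawn_promotes p m : legal p m -> board p (src m) = Some (turn p, Pawn) ->
  (promotion m == None) = (advance (turn p) (dst m) < 7).
Proof.
move=> lm bs; have := legal_promotion_ok lm bs; have t2 := ltn_ord (dst m).2.
rewrite /promotion_ok eqxx /= -val_eqE /advance.
case: ifP => [last pm|not_last /eqP->].
  have -> : (promotion m == None) = false.
    by move: pm; rewrite !inE => /or4P[] /eqP->.
  by move: last; case: (turn p) => /= /eqP e; lia.
by rewrite eqxx; move: not_last; case: (turn p) => /= /eqP e; lia.
Qed.

(** Why opposing pawns of one file block each other. *)
Lemma pawn_unobstructed p m v : legal p m ->
  board p (src m) = Some (turn p, Pawn) -> ~~ capturing p m ->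
  (dst m).1 = (src m).1 /\
  (v.1 = (src m).1 ->
   advance (turn p) (src m) < advance (turn p) v <= advance (turn p) (dst m) ->
   board p v = None).
Proof.
move=> lm bs; rewrite negb_or negbK => /andP[/eqP bt nep].
have := pawn_move_legal lm bs; rewrite /pawn_move (negPf nep) orbF.
have := ltn_ord (src m).2; have := ltn_ord (dst m).2; have := ltn_ord v.2.
move=> v2 t2 s2.
case/or3P => [/and3P[f a _]|/and5P[f a _ _ cl]|/andP[_]];
  last by rewrite /holds_color bt.
- have e1 : (dst m).1 = (src m).1.
    by apply: val_inj; move: f; rewrite /dfile /dist /=; lia.
  split=> // ev between; rewrite -bt; congr (board p _).
  rewrite [v]surjective_pairing [dst m]surjective_pairing ev e1; congr (_, _).
  apply: val_inj => /=; move: a between; rewrite /ahead /advance.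
  by case: (turn p); lia.
- have e1 : (dst m).1 = (src m).1.
    by apply: val_inj; move: f; rewrite /dfile /dist /=; lia.
  split=> // ev between.
  have [v_t|v_t] := eqVneq v (dst m); first by rewrite v_t.
  have [v_s|v_s] := eqVneq v (src m); first by move: between; rewrite v_s ltnn.
  apply/eqP; apply: (implyP (forallP cl v)).
  have vt2 : val v.2 != val (dst m).2.
    apply: contra v_t => /eqP e; apply/eqP.
    rewrite [v]surjective_pairing [dst m]surjective_pairing ev e1.
    by congr (_, _); apply: val_inj.
  rewrite /strictly_between v_s v_t /dfile /drank /= ev e1 /dist !subnn /=.
  rewrite mul0n muln0 eqxx andbT.
  by move: a between vt2 => /=; rewrite /ahead /advance; case: (turn p); lia.
Qed.

(** A pawn is named by its colour and the file it starts on. *)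
Notation pawn := (color * 'I_8)%type.

(** What has to be remembered of a game beyond the position: of each pawn its
    square while it is a pawn, whether it was captured as a pawn, and the numbers
    of its moves and of its captures; of the game as a whole the number of
    events, how often the player who makes them changed, and the number of plies
    since the last one. *)
Record ledger := Ledger {
  place : pawn -> option square;
  lost : pawn -> bool;
  steps : pawn -> nat;
  takes : pawn -> nat;
  events : nat;
  switches : nat;
  lull : nat
}.

Definition pawn_rank c : 'I_8 :=
  if c is White then @Ordinal 8 1 isT else @Ordinal 8 6 isT.

Definition blank : ledger := {|
  place := fun i => Some (i.2, pawn_rank i.1);
  lost := fun=> false; steps := fun=> 0; takes := fun=> 0;
  events := 0; switches := 0; lull := 0 |}.

(** The player of the last event. The start counts as an event of Black, because
    White has the move after it. *)
Definition last_color l := if odd (switches l) then White else Black.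

Definition entry p (m : move) (l : ledger) : ledger :=
  let moves i := place l i == Some (src m) in
  let hit i := if place l i is Some u then taken p m u else false in
  {| place := fun i =>
       if moves i then if promotion m == None then Some (dst m) else None
       else if hit i then None else place l i;
     lost := fun i => lost l i || ~~ moves i && hit i;
     steps := fun i => steps l i + moves i;
     takes := fun i => takes l i + (moves i && capturing p m);
     events := events l + ~~ quiet p m;
     switches := switches l + (~~ quiet p m && (turn p != last_color l));
     lull := if quiet p m then (lull l).+1 else 0 |}.

Inductive annotated : seq move -> position -> ledger -> Prop :=
| AnnotatedStart : annotated [::] initial blank
| AnnotatedMove ms p l m : annotated ms p l -> legal p m ->
    annotated (rcons ms m) (make p m) (entry p m l).

Lemma annotate ms : legal_line initial ms ->
  exists l, annotated ms (play initial ms) l.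
Proof.
elim/last_ind: ms => [|ms m IH]; first by exists blank; apply: AnnotatedStart.
rewrite -cats1 legal_line_cat /= andbT => /andP[/IH[l ann] lm].
exists (entry (play initial ms) m l); rewrite /play foldl_cat /= cats1.
exact: AnnotatedMove.
Qed.

Lemma annotated_play ms p l : annotated ms p l -> p = play initial ms.
Proof. by elim=> {ms p l} // ms p l m _ -> _; rewrite /play foldl_rcons. Qed.

Lemma place_board ms p l i u : annotated ms p l ->
  place l i = Some u -> board p u = Some (i.1, Pawn).
Proof.
move=> ann; elim: ann i u => {ms p l} [[c f] u [<-]|ms p l m _ IH lm i u] /=.
  by rewrite ffunE /=; case: c.
move=> place_u; apply/eqP; rewrite pawn_after //; move: place_u.
case: eqP => [/IH bs|not_src].
  by case: eqP => // _ [<-]; rewrite eqxx bs eqxx.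
case pl: (place l i) not_src => [v|] //; case: ifP => // not_taken v_src [evu].
rewrite -evu; case: eqP => [v_dst|_].
  by rewrite /taken v_dst eqxx in not_taken.
rewrite not_taken (IH _ _ pl) eqxx /= andbT.
by apply/eqP => e; rewrite e in v_src.
Qed.

Lemma board_place ms p l c u : annotated ms p l ->
  board p u = Some (c, Pawn) -> exists f, place l (c, f) = Some u.
Proof.
move=> ann; elim: ann c u => {ms p l} [c [x y]|ms p l m _ IH lm c u] /=.
  rewrite ffunE /= => e; exists x; congr (Some (_, _)); apply: val_inj.
  move: e; case: y => [y lty] /=.
  case: c; do 8?[case: y lty => [|y] lty //=]; move=> [];
    by case: x => x ltx /=; do 8?[case: x ltx => [|x] ltx //=].
move=> /eqP; rewrite pawn_after //; case: eqP => [->|not_dst].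
  by case/andP=> /eqP /IH[f pl] /eqP q_none; exists f; rewrite pl eqxx q_none.
case/and3P=> u_src not_taken /eqP /IH[f pl]; exists f.
by rewrite pl (negPf not_taken); case: eqP => // -[e]; rewrite e eqxx in u_src.
Qed.

Lemma place_inj ms p l i j u : annotated ms p l ->
  place l i = Some u -> place l j = Some u -> i = j.
Proof.
move=> ann; elim: ann i j u => {ms p l} [[c f] [c' f'] u|ms p l m _ IH lm i j u] /=.
  by move=> [<-] [-> e]; congr (_, _); case: c c' e => [] [].
case: (place l i =P _) => [pi|_]; case: (place l j =P _) => [pj|_].
- by move=> _ _; apply: (IH _ _ (src m)).
- case: eqP => // _ [<-]; case pj: (place l j) => [v|] //; case: ifP => // nt [e].
  by rewrite /taken e eqxx in nt.
- case pi: (place l i) => [v|] //; case: ifP => // nt [evu]; case: eqP => // _ [e].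
  by rewrite /taken evu -e eqxx in nt.
- case pi: (place l i) => [v|] //; case: ifP => // _ [evu].
  case pj: (place l j) => [w|] //; case: ifP => // _ [ewu].
  by apply: (IH _ _ u); rewrite ?pi ?pj ?evu ?ewu.
Qed.

Lemma moves_not_quiet ms p l m i : annotated ms p l ->
  place l i = Some (src m) -> ~~ quiet p m.
Proof. by move=> ann pi; rewrite quietE (place_board ann pi). Qed.

(** Every move of a pawn advances it by at least one rank, and six are the way
    to promotion. *)
Lemma steps_advance ms p l i : annotated ms p l ->
  if place l i is Some u then steps l i < advance i.1 u < 7 else steps l i <= 6.
Proof.
move=> ann; elim: ann i => {ms p l} [[[] f]|ms p l m ann IH lm i] //=.
have := IH i; case: eqP => [pi|_].
  rewrite pi => /andP[s_lt s7].
  have bs := place_board ann pi; have ci := mover_color lm bs.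
  have := pawn_advances lm; have := pawn_promotes lm.
  by rewrite -ci => /(_ bs) -> /(_ bs); case: ifP; lia.
by case: (place l i) => [u|]; rewrite addn0 //; case: ifP => //; lia.
Qed.

Lemma steps_le6 ms p l i : annotated ms p l -> steps l i <= 6.
Proof. by move/(steps_advance i); case: (place l i) => [u|]; lia. Qed.

Lemma lost_gone ms p l i : annotated ms p l -> lost l i -> place l i = None.
Proof.
move=> ann; elim: ann i => {ms p l} [|ms p l m ann IH lm i] //=.
case: eqP => [pi|_] /=; first by rewrite orbF => /IH; rewrite pi.
by case/orP=> [/IH-> //|]; case: (place l i) => [u|] //; case: ifP.
Qed.

Lemma unmoved_home ms p l i : annotated ms p l -> steps l i = 0 -> ~~ lost l i ->
  place l i = Some (i.2, pawn_rank i.1).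
Proof.
move=> ann; elim: ann i => {ms p l} [|ms p l m ann IH lm i] //=.
case: eqP => [_|_] /=; first by rewrite addn1.
by rewrite addn0 negb_or => s0 /andP[/(IH _ s0)-> /=]; case: ifP.
Qed.

Lemma takes_file ms p l i u : annotated ms p l ->
  takes l i = 0 -> place l i = Some u -> u.1 = i.2.
Proof.
move=> ann; elim: ann i u => {ms p l} [i u _ [<-]|ms p l m ann IH lm i u] //=.
case: eqP => [pi|_] /=; last first.
  rewrite addn0 => t0; case pi: (place l i) => [v|] //; case: ifP => // _ [<-].
  exact: IH t0 pi.
have bs := place_board ann pi; have ci := mover_color lm bs.
move=> t0; case: eqP => // _ [<-].
have [] := @pawn_unobstructed p m (dst m) lm _ _.
- by rewrite -ci.
- by case: (capturing p m) t0 => //; rewrite addn1.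
- by move=> -> _; apply: IH pi; lia.
Qed.

(** As long as neither pawn of a file captures they face each other, and four
    ranks lie between them at the start. So the first of them to go is captured,
    and when it has made at most four moves. *)
Lemma file_mates ms p l f : annotated ms p l ->
  takes l (White, f) = 0 -> takes l (Black, f) = 0 ->
  [\/ exists u v, [/\ place l (White, f) = Some u, place l (Black, f) = Some v &
        u.2 < v.2],
      place l (White, f) = None /\ steps l (White, f) <= 4 |
      place l (Black, f) = None /\ steps l (Black, f) <= 4].
Proof.
move=> ann; elim: ann f => {ms p l} [f _ _|ms p l m ann IH lm f].
  by apply: Or31; exists (f, pawn_rank White), (f, pawn_rank Black).
move=> /= tW tB.
have t0W : takes l (White, f) = 0 by lia.
have t0B : takes l (Black, f) = 0 by lia.
case: (IH f t0W t0B) => [[u [v [pW pB lt_uv]]]|[pW sW]|[pB sB]]; last first.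
- by apply: Or33; rewrite pB /= addn0.
- by apply: Or32; rewrite pW /= addn0.
have bW := place_board ann pW; have bB := place_board ann pB.
have file_uv : u.1 = v.1.
  by rewrite (takes_file ann t0W pW) (takes_file ann t0B pB).
have := steps_advance (White, f) ann; have := steps_advance (Black, f) ann.
rewrite pW pB /= => /andP[sB _] /andP[sW _].
have [W_moves|W_stays] := eqVneq (Some u) (Some (src m)).
  case: W_moves => eu; rewrite eu in bW.
  have cW := esym (mover_color lm bW); have bW' := bW; rewrite -cW in bW'.
  have ncap : ~~ capturing p m.
    by apply/negP => cap; move: tW; rewrite pW eu eqxx cap addn1.
  have [_ clear_v] := pawn_unobstructed v lm bW' ncap.
  have lt_tv : (dst m).2 < v.2.
    rewrite ltnNge; apply/negP => le_vt; move: clear_v; rewrite cW /= bB -eu.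
    by move/(_ (esym file_uv)); rewrite le_vt lt_uv => /(_ isT).
  have q_none := pawn_promotes lm bW'; rewrite cW /= in q_none.
  apply: Or31; exists (dst m), v; rewrite -eu q_none.
  have -> : (Some v == Some u) = false.
    by apply/eqP => -[e]; rewrite e ltnn in lt_uv.
  have -> : taken p m v = false.
    move: ncap; rewrite negb_or /taken => /andP[_ /negPf->]; rewrite orbF.
    by apply/eqP => e; rewrite e ltnn in lt_tv.
  by rewrite (_ : (dst m).2 < 7) //; have := ltn_ord v.2; lia.
have [B_moves|B_stays] := eqVneq (Some v) (Some (src m)).
  case: B_moves => ev; rewrite ev in bB.
  have cB := esym (mover_color lm bB); have bB' := bB; rewrite -cB in bB'.
  have ncap : ~~ capturing p m.
    by apply/negP => cap; move: tB; rewrite pB ev eqxx cap addn1.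
  have [_ clear_u] := pawn_unobstructed u lm bB' ncap.
  have lt_ut : u.2 < (dst m).2.
    rewrite ltnNge; apply/negP => le_tu; move: clear_u; rewrite cB /= bW -ev.
    have v8 := ltn_ord v.2; move/(_ file_uv) => none.
    by have : Some (White, Pawn) = None by apply: none; lia.
  have q_none := pawn_promotes lm bB'; rewrite cB /= in q_none.
  apply: Or31; exists u, (dst m); rewrite q_none.
  have -> : taken p m u = false.
    move: ncap; rewrite negb_or /taken => /andP[_ /negPf->]; rewrite orbF.
    by apply/eqP => e; rewrite e ltnn in lt_ut.
  by rewrite (_ : 7 - (dst m).2 < 7) //; lia.
rewrite !addn0.
case: (boolP (taken p m u)) => _; first by apply: Or32; split=> //; lia.
case: (boolP (taken p m v)) => _; first by apply: Or33; split=> //; lia.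
by apply: Or31; exists u, v.
Qed.

(** * Counting the events *)

Lemma sum_pred1 (I : finType) (P : pred I) (i0 : I) :
  P =1 pred1 i0 -> \sum_i (P i : nat) = 1.
Proof.
move=> eP; rewrite (bigD1 i0) //= eP /= eqxx big1 ?addn0 // => i ne.
by rewrite eP /= (negPf ne).
Qed.

Lemma moving_pawn ms p l m : annotated ms p l -> legal p m ->
  (exists2 i, board p (src m) = Some (turn p, Pawn) &
     (fun j => place l j == Some (src m)) =1 pred1 i) \/
  (~~ (if board p (src m) is Some (_, Pawn) then true else false) /\
     (fun j => place l j == Some (src m)) =1 pred0).
Proof.
move=> ann lm; case bs: (board p (src m)) => [[c []]|]; first last;
  try by right; split=> // j; apply/eqP => /(place_board ann); rewrite bs.
left; have ec := mover_color lm bs; have [f pf] := board_place ann bs.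
exists (c, f); first by rewrite ec.
by move=> j; apply/eqP/eqP => [/(place_inj ann)/(_ pf)|->].
Qed.

Lemma men_initial c : men (board initial) c <= 16.
Proof.
have /subset_leq_card : [set s | holds_color (board initial) c s] \subset
    setX [set: 'I_8] [set pawn_rank c; home_rank c].
  apply/subsetP => -[x [y lt_y]]; rewrite !inE /holds_color ffunE -!val_eqE /=.
  by case: c; do 8?[case: y lt_y => [|y] lt_y //=].
by rewrite cardsX cardsT card_ord cards2 => /leq_trans; apply; case: c.
Qed.

(** Events are pawn moves and captures, and the captures by pawns are both. *)
Lemma count_events ms p l : annotated ms p l ->
  events l + \sum_i takes l i + (men (board p) White + men (board p) Black) <=
  \sum_i steps l i + 32.
Proof.
elim=> {ms p l} [|ms p l m ann IH lm] /=.
  by rewrite !big1 // !add0n (leq_add (men_initial White) (men_initial Black)).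
have sum_men b : men b White + men b Black = men b (turn p) + men b (opp (turn p)).
  by case: (turn p); rewrite // addnC.
move: IH; rewrite !sum_men men_mover // !big_split /=.
have := men_other lm; rewrite quietE.
have [[i bs mv]|[bs mv]] := moving_pawn ann lm.
  rewrite (sum_pred1 mv) bs /=.
  have -> : \sum_j (place l j == Some (src m)) && capturing p m = capturing p m.
    case: (capturing p m); last by rewrite big1 // => j _; rewrite andbF.
    by rewrite -[RHS](sum_pred1 mv); apply: eq_bigr => j _; rewrite andbT.
  by case: (capturing p m) => /=; lia.
have stays j : (place l j == Some (src m)) = false by apply: mv.
have -> : \sum_j (place l j == Some (src m)) && capturing p m = 0.
  by rewrite big1 // => j _; rewrite stays.
have -> : \sum_j (place l j == Some (src m)) = 0.
  by rewrite big1 // => j _; rewrite stays.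
have -> : capturing p m = (board p (dst m) != None).
  rewrite /capturing /en_passant; case: (_ =P Some (turn p, Pawn)) => [e|_].
    by rewrite e in bs.
  by rewrite orbF.
have -> : (if board p (src m) is Some (_, Pawn) then false else true) = true.
  by move: bs; case: (board p (src m)) => [[c []]|].
by case: (board p (dst m) == None) => /=; lia.
Qed.

Lemma king_present ms p l c : annotated ms p l -> has_king (board p) c.
Proof.
elim=> {ms p l} [|ms p l m ann IH lm]; last exact: has_king_after.
by apply/existsP; exists (king_home c); rewrite ffunE; case: c.
Qed.

Lemma men_gt0 ms p l c : annotated ms p l -> 0 < men (board p) c.
Proof.
move/(king_present c) => /existsP[s /eqP bs]; apply/card_gt0P; exists s.
by rewrite inE /holds_color bs eqxx.
Qed.

Definition file_steps l f := steps l (White, f) + steps l (Black, f).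
Definition file_takes l f := takes l (White, f) + takes l (Black, f).
Definition all_steps l := \sum_(f < 8) file_steps l f.
Definition all_takes l := \sum_(f < 8) file_takes l f.

Lemma sum_by_file (F : pawn -> nat) :
  \sum_i F i = \sum_(f < 8) (F (White, f) + F (Black, f)).
Proof.
rewrite (eq_bigr (fun i => F (i.1, i.2))) => [|[c f] _] //.
rewrite -(pair_bigA _ (fun c f => F (c, f))) /= big_split /=.
rewrite (bigD1 White) //= (bigD1 Black) //= [X in _ + (_ + X)]big_pred0 ?addn0 //.
by case.
Qed.

Lemma count_events_by_file ms p l : annotated ms p l ->
  events l + all_takes l + (men (board p) White + men (board p) Black) <=
  all_steps l + 32.
Proof. by move/count_events; rewrite !sum_by_file. Qed.

Lemma file_steps_takes ms p l f : annotated ms p l ->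
  file_steps l f <= file_takes l f + 11 /\
  file_steps l f <= 2 * file_takes l f + 10.
Proof.
move=> ann; have sW := steps_le6 (White, f) ann.
have sB := steps_le6 (Black, f) ann; rewrite /file_steps /file_takes.
have [t0|] := posnP (takes l (White, f) + takes l (Black, f)); last by lia.
have tW : takes l (White, f) = 0 by lia.
have tB : takes l (Black, f) = 0 by lia.
case: (file_mates ann tW tB) => [[u [v [pW pB]]]|[_ ?]|[_ ?]]; try lia.
have := steps_advance (White, f) ann; have := steps_advance (Black, f) ann.
by rewrite pW pB /=; lia.
Qed.

Lemma leq_sum_files (F G : 'I_8 -> nat) c : (forall f, F f <= G f + c) ->
  \sum_f F f <= \sum_f G f + 8 * c.
Proof.
move=> leFG; apply: (@leq_trans (\sum_f (G f + c))).
  by apply: leq_sum => f _; apply: leFG.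
by rewrite big_split /= sum_nat_const card_ord.
Qed.

Lemma events_men ms p l : annotated ms p l ->
  events l + (men (board p) White + men (board p) Black) <= 120.
Proof.
move=> ann; have := count_events_by_file ann.
suff : all_steps l <= all_takes l + 8 * 11 by lia.
by apply: leq_sum_files => f; have [] := file_steps_takes f ann.
Qed.

(** * At most two changes of the player who makes the events *)

Lemma event_color p m l : ~~ quiet p m -> turn p = last_color (entry p m l).
Proof.
move=> nq; rewrite /last_color /= nq oddD /last_color.
by case: (turn p) (odd (switches l)) => [] [].
Qed.

Lemma opening_white ms p l f : annotated ms p l -> switches l = 0 ->
  steps l (White, f) = 0.
Proof.
move=> ann; elim: ann f => {ms p l} [|ms p l m ann IH lm] //= f s0.
have {}IH : steps l (White, f) = 0 by apply: IH; lia.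
rewrite IH; case: eqP => // pi.
have nq := moves_not_quiet ann pi; have := event_color l nq.
rewrite /last_color [switches _]/= s0 /=.
by rewrite -(mover_color lm (place_board ann pi)).
Qed.

Definition spared l := forall f, lost l (White, f) -> 0 < steps l (White, f).

Lemma spared_before ms p l m :
  annotated ms p l -> spared (entry p m l) -> spared l.
Proof.
move=> ann sp f lf; have := sp f.
by rewrite /= lf (lost_gone ann lf) /= addn0; apply.
Qed.

(** As long as only Black has made events, the white pawns fill the second rank
    and stop the black pawns; White's own events do not move these. *)
Lemma opening_black ms p l f : annotated ms p l ->
  switches l <= 1 -> spared l ->
  if place l (Black, f) is Some u then 2 <= u.2 else lost l (Black, f).
Proof.
move=> ann; elim: ann f => {ms p l} [|ms p l m ann IH lm] //= f s1 sp.
have := IH f _ (spared_before ann sp).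
rewrite (leq_trans (leq_addr _ _) s1) => /(_ isT) {IH}.
case: eqP => [pi|_] /=; last first.
  by case: (place l (Black, f)) => [u|->] //; case: ifP => //; rewrite orbT.
rewrite pi orbF => s2.
have bs := place_board ann pi; have cB := mover_color lm bs.
have := event_color l (moves_not_quiet ann pi); rewrite -cB /last_color => sw.
have {s1 sw} s0 : switches l = 0.
  by move: s1 sw => /=; case: (_ && _) => /=; case: (switches l) => [|[|?]].
have := pawn_reach lm; rewrite -cB => /(_ bs); rewrite /advance => reach.
suff t2 : 2 <= (dst m).2.
  have := pawn_promotes lm; rewrite -cB => /(_ bs) -> /=.
  by rewrite (_ : 7 - (dst m).2 < 7) //; lia.
rewrite ltnNge; apply/negP => t1.
(* A black pawn on the second rank stands where an unmoved white pawn stood,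
   which it must have captured. *)
have {reach} et : dst m = ((dst m).1, pawn_rank White).
  rewrite [LHS]surjective_pairing; congr (_, _); apply: val_inj => /=.
  by have := ltn_ord (src m).2; move: reach => /=; lia.
have un := opening_white (dst m).1 ann s0.
have not_lost : ~~ lost l (White, (dst m).1).
  by apply/negP => /(spared_before ann sp); rewrite un.
have pW := unmoved_home ann un not_lost; rewrite /= -et in pW.
have ts : (Some (dst m) == Some (src m)) = false.
  by apply/eqP => -[e]; rewrite -e ltnNge t1 in s2.
have := sp (dst m).1; rewrite /= pW ts /= un /taken eqxx orbT.
by move/(_ isT).
Qed.

(** Black pawns are captured only in White's block of events, and then they are
    still on their side of the second rank, two moves short of promotion. *)
Lemma early_losses ms p l f : annotated ms p l -> switches l <= 2 -> spared l ->
  lost l (Black, f) -> steps l (Black, f) <= 4.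
Proof.
move=> ann; elim: ann f => {ms p l} [|ms p l m ann IH lm] //= f s2 sp.
have sp0 := spared_before ann sp.
case/orP=> [lf|].
  rewrite (lost_gone ann lf) addn0; apply: IH lf => //.
  exact: leq_trans (leq_addr _ _) s2.
case/andP=> /negPf->; rewrite addn0.
case pi: (place l (Black, f)) => [u|] // hit.
have tW := taken_color lm hit (place_board ann pi).
have nq : ~~ quiet p m.
  apply: contraL hit => /quiet_not_capturing; rewrite negb_or negbK /taken.
  case/andP=> /eqP bt /negPf->; rewrite orbF; apply/eqP => e.
  by have := place_board ann pi; rewrite e bt.
have := event_color l nq; rewrite tW /last_color => sw.
have s1 : switches l <= 1.
  by move: s2 sw => /=; case: (_ && _); case: (switches l) => [|[|[|?]]] //=; lia.
have := opening_black f ann s1 sp0; have := steps_advance (Black, f) ann.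
by rewrite pi /=; have := ltn_ord u.2; lia.
Qed.

Lemma pawns_and_king ms p l c : annotated ms p l ->
  \sum_(f < 8) (place l (c, f) != None) < men (board p) c.
Proof.
move=> ann; have /existsP[k /eqP bk] := king_present c ann.
have -> : \sum_(f < 8) (place l (c, f) != None) =
          #|[set f | place l (c, f) != None]|.
  rewrite -sum1dep_card [RHS]big_mkcond; apply: eq_bigr => f _.
  by case: (place l (c, f)).
have -> : #|[set f | place l (c, f) != None]| =
    #|[set odflt k (place l (c, f)) | f in [set f | place l (c, f) != None]]|.
  rewrite card_in_imset // => f f'; rewrite !inE.
  case pf: (place l (c, f)) => [u|] //.
  case pf': (place l (c, f')) => [v|] //= _ _ euv.
  by rewrite -euv in pf'; have [] := place_inj ann pf pf'.
rewrite /men [X in _ < X](cardsD1 k) inE /holds_color bk eqxx.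
apply: subset_leq_card; apply/subsetP => u /imsetP[f]; rewrite !inE => pf ->.
case pf': (place l (c, f)) pf => [v|] // _ /=; have bv := place_board ann pf'.
by rewrite /holds_color bv eqxx andbT; apply/eqP => e; rewrite e bk in bv.
Qed.

(** Before Black's second block of events the black pawns that are not lost are
    still pawns, so this counts pawns on the board; in that block no black man
    disappears. *)
Lemma black_reserve ms p l : annotated ms p l -> switches l <= 2 -> spared l ->
  \sum_(f < 8) ~~ lost l (Black, f) < men (board p) Black.
Proof.
elim=> {ms p l} [|ms p l m ann IH lm] s2 sp.
  apply: leq_ltn_trans (pawns_and_king Black AnnotatedStart).
  exact: leq_sum.
have ann' := AnnotatedMove ann lm; have sp0 := spared_before ann sp.
have [s1|s1] := leqP (switches (entry p m l)) 1.
  apply: leq_ltn_trans (pawns_and_king Black ann'); apply: leq_sum => f _.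
  have := opening_black f ann' s1 sp.
  by case: (place _ _) => [u|->] //; case: (lost _ _).
have keep : men (board p) Black <= men (board (make p m)) Black.
  have [/quiet_not_capturing/men_not_capturing-> //|/event_color] :=
    boolP (quiet p m).
  move/(_ l); rewrite /last_color (_ : switches (entry p m l) = 2); last by lia.
  by move=> /= cB; rewrite -cB men_mover.
have s2' : switches l <= 2 := leq_trans (leq_addr _ _) s2.
apply: leq_trans keep; apply: leq_ltn_trans (IH s2' sp0).
by apply: leq_sum => f _ /=; case: (lost l _); rewrite //= leq_b1.
Qed.

Lemma events_few_switches ms p l : annotated ms p l ->
  switches l <= 2 -> events l <= 116.
Proof.
move=> ann s2; have := count_events_by_file ann.
have := men_gt0 White ann; have := men_gt0 Black ann.
have [/existsP[f /andP[lf /eqP sf]]|no_loss] :=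
  boolP [exists f, lost l (White, f) && (steps l (White, f) == 0)].
  suff : all_steps l <= all_takes l + 83 by lia.
  rewrite /all_steps /all_takes (bigD1 f) //= [X in _ <= X + _](bigD1 f) //=.
  have : \sum_(i < 8 | i != f) file_steps l i <=
         \sum_(i < 8 | i != f) (file_takes l i + 11).
    by apply: leq_sum => i _; have [] := file_steps_takes i ann.
  rewrite [X in _ <= X -> _]big_split /= sum_nat_cond_const.
  rewrite (_ : #|_| = 7); last first.
    rewrite (eq_card (B := [set~ f])) ?cardsC1 ?card_ord // => i.
    by rewrite !inE.
  have : file_steps l f <= 6 by rewrite /file_steps sf (steps_le6 _ ann).
  move: (\sum_(i | i != f) file_steps l i) (\sum_(i | i != f) file_takes l i).
  by move=> S T; lia.
have sp : spared l.
  move=> f lf; rewrite lt0n; apply: contra no_loss => sf.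
  by apply/existsP; exists f; rewrite lf.
have reserve := black_reserve ann s2 sp.
have : all_steps l <= \sum_(f < 8) 2 * ~~ lost l (Black, f) + 8 * 10.
  apply: leq_sum_files => f; rewrite /file_steps.
  have := early_losses ann s2 sp (f := f).
  have := steps_le6 (White, f) ann; have := steps_le6 (Black, f) ann.
  by case: (lost _ _) => /= sB sW; [move/(_ isT)|]; lia.
have : all_steps l <= \sum_f 2 * file_takes l f + 8 * 10.
  by apply: leq_sum_files => f; have [] := file_steps_takes f ann.
have : \sum_(f < 8) ~~ lost l (Black, f) <= 8.
  apply: (@leq_trans (\sum_(f < 8) 1)); last by rewrite sum1_card card_ord.
  by apply: leq_sum => f _; case: (lost _ _).
rewrite -!big_distrr /= -/(all_takes l); move: reserve.
by set N := \sum_(f < 8) _; lia.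
Qed.

(** * The upper bound *)

Definition only_kings (b : board_type) :=
  forall u pc, b u = Some pc -> pc.2 = King.

Lemma only_kings_after p m : legal p m ->
  only_kings (board p) -> only_kings (board (make p m)).
Proof.
move=> lm ok; case: (legal_effect lm) => [k bs _|bs _|d _ _ _ _ _ br _ _].
- have kK : k = King := ok _ _ bs.
  have q_none : promotion m = None.
    by apply/eqP; have := legal_promotion_ok lm bs; rewrite kK.
  move=> u pc; rewrite !putE /arrival q_none kK; case: ifP => [_ [<-] //|_].
  by case: ifP => // _; apply: ok.
- by have := ok _ _ bs.
- by have := ok _ _ br.
Qed.

Lemma attacks_king_sym b c c' s t :
  attacks b (c, King) s t = attacks b (c', King) t s.
Proof. by rewrite /attacks /dfile /drank /dist /= addnC [_ - t.2 + _]addnC. Qed.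

(** A king can be attacked only by the other king, which would be attacked as
    well, and its owner has just moved. *)
Lemma only_kings_dead p : only_kings (board p) ->
  ~~ in_check (board p) (opp (turn p)) -> dead p.
Proof.
move=> ok nc [ms []]; elim: ms p ok nc => [|m ms IH] p ok nc /=.
  move=> _ /andP[_ /existsP[s /andP[/eqP bs]]].
  case/existsP=> s' /existsP[k /andP[/eqP bs' att]].
  move/negP: nc; apply; apply/existsP; exists s'.
  have kK : k = King := ok _ _ bs'.
  rewrite bs' kK eqxx; apply/existsP; exists s; apply/existsP; exists King.
  rewrite bs (_ : opp (opp (turn p)) = turn p); last by case: (turn p).
  by rewrite eqxx (attacks_king_sym _ _ (opp (turn p))) -kK.
by case/andP=> lm; apply: IH; [apply: only_kings_after|apply: legal_not_in_check].
Qed.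

Lemma two_men_only_kings ms p l : annotated ms p l ->
  men (board p) White + men (board p) Black = 2 -> only_kings (board p).
Proof.
move=> ann two u [c k] bu /=.
have one : men (board p) c = 1.
  by have := men_gt0 White ann; have := men_gt0 Black ann; case: (c); lia.
have /existsP[s /eqP bs] := king_present c ann.
have /cards1P[w ew] : men (board p) c == 1 by rewrite one.
have : s \in [set w] by rewrite -ew inE /holds_color bs eqxx.
have : u \in [set w] by rewrite -ew inE /holds_color bu eqxx.
by rewrite !inE => /eqP eu /eqP es; move: bu; rewrite eu -es bs => -[].
Qed.

Lemma dead_at_118 ms p l : annotated ms p l -> 118 <= events l -> dead p.
Proof.
move=> ann ev.
have two : men (board p) White + men (board p) Black = 2.
  have := events_men ann; have := men_gt0 White ann; have := men_gt0 Black ann.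
  by lia.
apply: only_kings_dead; first exact: two_men_only_kings ann two.
by case: ann ev {two} => // ms' p' l' m _ lm _; apply: legal_not_in_check.
Qed.

Lemma lull_quiet ms p l : annotated ms p l ->
  exists ms1 ms2, [/\ ms = ms1 ++ ms2, size ms2 = lull l &
    quiet_line (play initial ms1) ms2].
Proof.
elim=> {ms p l} [|ms p l m ann [ms1 [ms2 [ems size2 quiet2]]] lm] /=.
  by exists [::], [::].
case: ifP => qm; last by exists (rcons ms m), [::]; rewrite cats0.
exists ms1, (rcons ms2 m); rewrite ems rcons_cat size_rcons size2; split=> //.
rewrite -cats1 quiet_line_cat quiet2 /= andbT /play -foldl_cat -ems.
by rewrite -[foldl _ _ _]/(play initial ms) -(annotated_play ann).
Qed.

(** The parity of the lull tells whether the player to move made the last event.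
    If not, the lull is even; so an event that changes the player comes after at
    most 148 quiet plies, and the ply lost pays for the change. *)
Lemma time_bound ms p l : annotated ms p l ->
  (forall n, n < size ms -> ~ terminated (take n ms)) ->
  [/\ size ms + switches l <= 150 * events l + lull l, lull l <= 150,
      events l = 118 -> lull l = 0 &
      turn p = if odd (lull l) then last_color l else opp (last_color l)].
Proof.
elim=> {ms p l} [|ms p l m ann IH lm] open //.
have {IH} [] := IH _.
  move=> n lt_n; have := open n.
  rewrite size_rcons ltnS (ltnW lt_n) => /(_ isT).
  by rewrite -cats1 takel_cat // ltnW.
have {open} going : ~ terminated ms.
  have := open (size ms); rewrite size_rcons ltnSn -cats1 take_size_cat //.
  by apply.
move=> time lull150 _ turn_p.
have lull149 : lull l < 150.
  rewrite ltn_neqAle lull150 andbT; apply/eqP => e150; apply: going; apply: Or33.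
  have [ms1 [ms2 [ems size2 quiet2]]] := lull_quiet ann.
  by exists ms1, ms2, [::]; rewrite cats0 size2 e150.
have ev117 : events l <= 117.
  rewrite leqNgt; apply/negP => ev; apply: going; apply: Or31; apply: Or33.
  by rewrite -(annotated_play ann); apply: dead_at_118 ann ev.
rewrite turn_make // size_rcons.
have [qm|nq] := boolP (quiet p m).
  rewrite /last_color /= qm /= !addn0 addnS ltnS; split=> //; first by lia.
  by rewrite turn_p /last_color; case: (odd _); case: (odd _).
split=> //=; last 2 first.
- by rewrite (negPf nq).
- by rewrite (negPf nq) /= -event_color.
- rewrite nq (negPf nq) /=.
  suff : lull l + (turn p != last_color l) < 150 by lia.
  rewrite turn_p; case: ifP => [_|]; first by rewrite eqxx addn0.
  have -> : opp (last_color l) != last_color l by rewrite opp_eqF.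
  by lia.
- by case: ifP.
Qed.

Lemma game_size ms : game ms -> size ms <= 17697.
Proof.
case=> /annotate[l ann] open.
have [time lull150 ev118 _] := time_bound ann open; have ev := events_men ann.
have mW := men_gt0 White ann; have mB := men_gt0 Black ann.
suff bound : size ms <= 150 * 118 - 3 by rewrite (leq_trans bound).
have [/(events_few_switches ann)|] := leqP (switches l) 2; first by lia.
have [e|] := eqVneq (events l) 118; first by rewrite ev118 // e in time; lia.
by lia.
Qed.

(** * Legal moves on a concrete board *)

(** Boards as lists of ranks, on which moves can be computed. *)
Definition grid := seq (seq (option piece)).
Definition lookup (g : grid) (s : square) := nth None (nth [::] g s.2) s.1.
Definition store (g : grid) (s : square) x : grid :=
  set_nth [::] g s.2 (set_nth None (nth [::] g s.2) s.1 x).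

Definition diagram := (color * grid)%type.

Definition files : seq 'I_8 :=
  [:: @Ordinal 8 0 isT; @Ordinal 8 1 isT; @Ordinal 8 2 isT; @Ordinal 8 3 isT;
      @Ordinal 8 4 isT; @Ordinal 8 5 isT; @Ordinal 8 6 isT; @Ordinal 8 7 isT].
Definition squares : seq square := [seq (x, y) | y <- files, x <- files].

Definition toward (i j k : nat) :=
  if i <= j then i + minn k (j - i) else i - minn k (i - j).

(** The squares strictly between two squares of one line. *)
Definition segment (s t : square) : seq square :=
  [seq (nth ord0 files (toward s.1 t.1 k), nth ord0 files (toward s.2 t.2 k)) |
     k <- iota 1 (maxn (dfile s t) (drank s t)).-1].

Definition grid_clear g s t :=
  all (fun u => if lookup g u is None then true else false) (segment s t).

(* The conditionals, here and below, keep a computation from evaluating both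
   sides of a conjunction. *)
Definition grid_attacks g (pc : piece) (s t : square) : bool :=
  match pc.2 with
  | Pawn => pawn_attack pc.1 s t
  | Knight => (dfile s t == 1) && (drank s t == 2) ||
              (dfile s t == 2) && (drank s t == 1)
  | Bishop => if diagonal s t then grid_clear g s t else false
  | Rook => if orthogonal s t then grid_clear g s t else false
  | Queen =>
      if diagonal s t || orthogonal s t then grid_clear g s t else false
  | King => maxn (dfile s t) (drank s t) == 1
  end.

Definition same_color c c' :=
  match c, c' with White, White | Black, Black => true | _, _ => false end.

Definition grid_attacked g c t :=
  has (fun s => if lookup g s is Some (c', k) then
     if same_color c' c then grid_attacks g (c, k) s t else false
   else false) squares.

Definition grid_in_check g c :=
  has (fun s => if lookup g s is Some (c', King) then
     if same_color c' c then grid_attacked g (opp c) s else false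
   else false) squares.

Definition grid_move (g : grid) c k (m : move) : grid :=
  store (store g (src m) None) (dst m) (Some (c, odflt k (promotion m))).

Definition diagram_make (P : diagram) (m : move) : diagram :=
  if lookup P.2 (src m) is Some (c, k) then (opp c, grid_move P.2 c k m) else P.

(** A sufficient condition for legality: it leaves out castling, the double step
    of a pawn and en passant, which the game below does without. *)
Definition plain_legal (P : diagram) (m : move) : bool :=
  let: (c, g) := P in let s := src m in let t := dst m in
  if lookup g s is Some (c', k) then
    [&& same_color c' c,
        (if lookup g t is Some (c'', k') then
           if same_color c'' c then false else if k' is King then false else true
         else true),
        promotion_ok c k m,
        (if k is Pawn then
           if lookup g t is None then (dfile s t == 0) && ahead c 1 s t
           else pawn_attack c s t
         else grid_attacks g (c, k) s t) &
        ~~ grid_in_check (diagram_make P m).2 c]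
  else false.

Fixpoint plain_line (P : diagram) ms :=
  if ms is m :: ms' then
    if plain_legal P m then plain_line (diagram_make P m) ms' else false
  else true.

Definition play_diagram := foldl diagram_make.

Definition initial_diagram : diagram := (White,
  [seq [seq match val y with
    | 0 => Some (White, nth Rook back_rank x)
    | 1 => Some (White, Pawn)
    | 6 => Some (Black, Pawn)
    | 7 => Some (Black, nth Rook back_rank x)
    | _ => None
    end | x : 'I_8 <- files] | y : 'I_8 <- files]).

Definition depicts (P : diagram) (p : position) :=
  [/\ turn p = P.1, forall u, board p u = lookup P.2 u & double_step p = None].

Lemma lookup_store g s x u :
  lookup (store g s x) u = if u == s then x else lookup g u.
Proof.
rewrite /lookup /store nth_set_nth /= -[in RHS]pair_eqE /= -!val_eqE /=.
case: (val u.2 =P val s.2) => [e2|]; last by rewrite andbF.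
by rewrite andbT nth_set_nth /= e2; case: eqP.
Qed.

Lemma mem_files i : i \in files.
Proof. by case: i => m lt_m8; do 8![case: m lt_m8 => // m lt_m8]. Qed.

Lemma mem_squares u : u \in squares.
Proof. by case: u => x y; apply: allpairs_f; apply: mem_files. Qed.

Lemma mem_segment s t u : orthogonal s t || diagonal s t ->
  strictly_between s u t = (u \in segment s t).
Proof.
pose ok s t := orthogonal s t || diagonal s t ==>
  all (fun u => strictly_between s u t == (u \in segment s t)) squares.
have ok_all : all (fun s => all (ok s) squares) squares.
  by vm_cast_no_check (erefl true).
move=> line; have /allP/(_ t (mem_squares t)) := allP ok_all s (mem_squares s).
by rewrite /ok line => /allP/(_ u (mem_squares u))/eqP.
Qed.

Lemma same_colorE c c' : same_color c c' = (c == c').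
Proof. by case: c c' => [] []. Qed.

Section DepictedBoard.

Variables (g : grid) (b : board_type).
Hypothesis gb : forall u, b u = lookup g u.

Lemma grid_clearE s t : orthogonal s t || diagonal s t ->
  grid_clear g s t = clear b s t.
Proof.
move=> line; apply/allP/forallP => [free_st u | clear_st u].
  rewrite (mem_segment _ line); apply/implyP => /free_st.
  by rewrite gb; case: lookup.
rewrite -(mem_segment _ line) => /(implyP (clear_st u)).
by rewrite gb; case: lookup.
Qed.

Lemma grid_attacksE pc s t : grid_attacks g pc s t = attacks b pc s t.
Proof.
rewrite /grid_attacks /attacks; case: pc.2 => //.
- by case: ifP => // d; rewrite grid_clearE // d orbT.
- by case: ifP => // o; rewrite grid_clearE // o.
- by case: ifP => // d; rewrite grid_clearE // orbC.
Qed.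

Lemma grid_attackedE c t : grid_attacked g c t = attacked b c t.
Proof.
apply/hasP/existsP => [[s _ st] | [s /existsP[k /andP[/eqP bs st]]]].
  exists s; apply/existsP; move: st; case gs: lookup => [[c' k]|] //.
  rewrite same_colorE; case: eqP => // cc' st; exists k.
  by rewrite gb gs cc' eqxx -grid_attacksE.
exists s; rewrite ?mem_squares //.
by rewrite -gb bs same_colorE eqxx grid_attacksE.
Qed.

Lemma grid_in_checkE c : grid_in_check g c = in_check b c.
Proof.
apply/hasP/existsP => [[s _ st] | [s /andP[/eqP bs st]]].
  exists s; move: st; case gs: lookup => [[c' []]|] //.
  by rewrite same_colorE; case: eqP => // <-; rewrite gb gs eqxx grid_attackedE.
exists s; rewrite ?mem_squares //.
by rewrite -gb bs same_colorE eqxx grid_attackedE.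
Qed.

End DepictedBoard.

Lemma en_passant_none p c s t :
  double_step p = None -> en_passant p c s t = false.
Proof. by rewrite /en_passant => ->; rewrite /= !andbF. Qed.

Lemma king_step_not_castling c d s t :
  maxn (dfile s t) (drank s t) == 1 -> s == king_home c ->
  (t == king_castled c d) = false.
Proof.
move=> st /eqP e; apply/eqP => e'; move: st.
by rewrite {}e {}e'; case: c d => [] [].
Qed.

Lemma depicts_initial : depicts initial_diagram initial.
Proof.
split=> //= -[[x ltx] [y lty]]; rewrite ffunE /=.
by case: y lty; do 8?[case=> //]; case: x ltx; do 8?[case=> //].
Qed.

Lemma depicts_make P p m : depicts P p -> plain_legal P m ->
  legal p m /\ depicts (diagram_make P m) (make p m).
Proof.
case: P => c g [/= pc gb ds]; case: m => [[s t] q].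
rewrite /diagram_make /legal /possible /make /pseudo_legal /src /dst /= pc gb.
case gs: (lookup g s) => [[c' k]|] //.
rewrite same_colorE => /and5P[/eqP-> ok_t ok_q ok_m ok_c].
have e0 : moved_board p c k (s, t, q) =
    [ffun u => lookup (grid_move g c k (s, t, q)) u].
  rewrite /moved_board /src /dst /= en_passant_none //.
  set b0 := put (put (board p) s None) t _.
  have b0E : b0 = [ffun u => lookup (grid_move g c k (s, t, q)) u].
    by apply/ffunP => u; rewrite !ffunE /grid_move !lookup_store gb.
  case: ifP => // /andP[/eqP k_king s_home]; rewrite k_king /= in ok_m.
  by rewrite !(king_step_not_castling _ ok_m s_home).
rewrite {}e0 eqxx.
have drank_st : k = Pawn -> drank s t != 2.
  move=> k_pawn; rewrite k_pawn in ok_m; move: ok_m.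
  rewrite /pawn_attack /drank /dist /ahead.
  by case: lookup => [_|]; case: (c); lia.
split.
  apply/andP; split.
    apply/and5P; split=> //.
    - rewrite /holds_color gb; case: lookup ok_t => [[c'' k']|] //.
      by rewrite same_colorE; case: ifP.
    - rewrite gb; case: lookup ok_t => [[c'' k']|] //.
      by case: ifP => // _ k'_ok; apply/eqP => -[_ k'K]; rewrite k'K in k'_ok.
    - case: k ok_m {ok_q gs ok_c drank_st} => //; rewrite ?(grid_attacksE gb) //.
      + rewrite /pawn_move /holds_color gb.
        case gt: (lookup g t) ok_t => [[c'' k']|] ok_t.
          rewrite same_colorE in ok_t => st; rewrite st /=.
          move: ok_t; case: eqP => // nc _.
          rewrite [c'' == _](_ : _ = true) ?orbT //.
          by case: (c) (c'') nc => [] [].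
        by move=> /andP[-> ->].
      + by move=> ->.
  move: ok_c; rewrite /= (grid_in_checkE
    (b := [ffun u => lookup (grid_move g c k (s, t, q)) u])) //.
  by move=> u; rewrite ffunE.
split=> //= [u|]; first by rewrite ffunE.
by case: ifP => // /andP[/eqP/drank_st/negPf->].
Qed.

Lemma depicts_line P p ms : depicts P p -> plain_line P ms -> legal_line p ms.
Proof.
elim: ms P p => //= m ms IH P p Pp; case: ifP => // ok_m ok_ms.
by have [-> /IH->] := depicts_make Pp ok_m.
Qed.

Lemma depicts_play P p ms : depicts P p -> plain_line P ms ->
  depicts (play_diagram P ms) (play p ms).
Proof.
elim: ms P p => //= m ms IH P p Pp; case: ifP => // ok_m ok_ms.
by have [_ /IH] := depicts_make Pp ok_m; exact.
Qed.

Lemma plain_line_cat P ms1 ms2 :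
  plain_line P (ms1 ++ ms2) =
  plain_line P ms1 && plain_line (play_diagram P ms1) ms2.
Proof. by elim: ms1 P => //= m ms1 IH P; case: ifP. Qed.

(** * Computing the ends of a game *)

Definition grid_quiet g (m : move) :=
  match lookup g (src m), lookup g (dst m) with
  | Some (_, Pawn), _ => false | _, None => true | _, _ => false
  end.

Fixpoint grid_quiet_line (P : diagram) ms :=
  if ms is m :: ms' then
    if grid_quiet P.2 m then grid_quiet_line (diagram_make P m) ms' else false
  else true.

(** [n] is the number of quiet plies just before [ms]. *)
Fixpoint short_lulls n (P : diagram) (ms : seq move) : bool :=
  if ms is m :: ms' then
    let n' := if grid_quiet P.2 m then n.+1 else 0 in
    if n' < 150 then short_lulls n' (diagram_make P m) ms' else false
  else true.

Lemma grid_quietE P p m : depicts P p -> quiet p m = grid_quiet P.2 m.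
Proof.
case=> _ gb _; rewrite quietE !gb /grid_quiet.
by case: (lookup _ (src m)) => [[c []]|]; case: lookup.
Qed.

Lemma grid_quiet_lineE P p ms : depicts P p -> plain_line P ms ->
  grid_quiet_line P ms = quiet_line p ms.
Proof.
elim: ms P p => //= m ms IH P p Pp; case: ifP => // ok_m ok_ms.
rewrite (grid_quietE m Pp); case: ifP => // _.
by have [_ Pp'] := depicts_make Pp ok_m; apply: IH.
Qed.

Lemma short_lulls_cat n P ms1 ms2 : short_lulls n P (ms1 ++ ms2) -> n < 150 ->
  short_lulls n P ms1 /\
  exists2 n', n' < 150 & short_lulls n' (play_diagram P ms1) ms2.
Proof.
elim: ms1 n P => [|m ms1 IH] n P /=; first by split; last exists n.
by case: ifP => // lt_n' /IH/(_ lt_n').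
Qed.

Lemma quiet_line_short n P p ms : depicts P p -> plain_line P ms -> n < 150 ->
  short_lulls n P ms -> quiet_line p ms -> n + size ms < 150.
Proof.
elim: ms n P p => [|m ms IH] n P p Pp /=; first by rewrite addn0.
case: ifP => // ok_m ok_ms lt_n; rewrite (grid_quietE m Pp).
case: ifP => // lt_n' short_ms /andP[quiet_m quiet_ms].
rewrite quiet_m in lt_n' short_ms; rewrite addnS -addSn.
by have [_ Pp'] := depicts_make Pp ok_m; apply: (IH _ _ _ Pp').
Qed.

Lemma short_lulls_not_seventy_five ms : plain_line initial_diagram ms ->
  short_lulls 0 initial_diagram ms -> ~ seventy_five_moves ms.
Proof.
move=> ok short_ms [ms1 [ms2 [ms3 [e size2 quiet2]]]].
move: ok short_ms; rewrite e !plain_line_cat => /and3P[ok1 ok2 _].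
case/short_lulls_cat=> // _ [n lt_n /short_lulls_cat[] // short2 _].
have P1 := depicts_play depicts_initial ok1.
have := quiet_line_short P1 ok2 lt_n short2 quiet2.
by rewrite size2 ltnNge leq_addl.
Qed.

Inductive trie := Leaf | Node of nat & trie & trie.

Fixpoint multiplicity (T : trie) (k : seq bool) : nat :=
  match T, k with
  | Leaf, _ => 0
  | Node n _ _, [::] => n
  | Node _ l r, b :: k' => multiplicity (if b then l else r) k'
  end.

Fixpoint insert (T : trie) (k : seq bool) : trie :=
  let: (n, l, r) := if T is Node n l r then (n, l, r) else (0, Leaf, Leaf) in
  match k with
  | [::] => Node n.+1 l r
  | b :: k' => if b then Node n (insert l k') r else Node n l (insert r k')
  end.

Lemma multiplicity_insert T k k' :
  multiplicity (insert T k) k' = multiplicity T k' + (k == k').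
Proof.
elim: k T k' => [|b k IH] T [|b' k'].
- by case: T => [|n l r] /=; rewrite addn1.
- by case: T b' => [|n l r] [] /=; case: k' => [|? ?]; rewrite addn0.
- by case: T b => [|n l r] [] /=; rewrite addn0.
- by case: T b b' => [|n l r] [] [] /=; rewrite ?IH ?addn0 ?eqseq_cons.
Qed.

(** Equal positions have equal keys, so if no key occurs five times then no
    position does. *)
Definition key_of (c : color) (xs : seq (option piece)) : seq bool :=
  bool_of_color c ::
  flatten [seq if x is Some (c, k) then
      true :: bool_of_color c ::
      match k with
      | Pawn => [:: true; true; true] | Knight => [:: true; true; false]
      | Bishop => [:: true; false; true] | Rook => [:: true; false; false]
      | Queen => [:: false; true; true] | King => [:: false; true; false]
      end
    else [:: false] | x <- xs].

Definition key (P : diagram) := key_of P.1 [seq lookup P.2 s | s <- squares].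
Definition key_at (p : position) := key_of (turn p) [seq board p s | s <- squares].

(** [T] counts the keys of the positions before [P]. *)
Fixpoint never_fifth (T : trie) (P : diagram) (ms : seq move) : bool :=
  let k := key P in
  if multiplicity T k < 4 then
    if ms is m :: ms' then never_fifth (insert T k) (diagram_make P m) ms'
    else true
  else false.

Lemma key_depicts P p : depicts P p -> key P = key_at p.
Proof.
case=> pc gb _; rewrite /key /key_at pc; congr key_of.
by apply: eq_map => s; rewrite gb.
Qed.

Lemma never_fifth_count T P p ms k : depicts P p -> plain_line P ms ->
  never_fifth T P ms -> (forall k', multiplicity T k' <= 4) ->
  multiplicity T k + count (fun q => key_at q == k) (p :: scanl make p ms) <= 4.
Proof.
elim: ms T P p => [|m ms IH] T P p Pp /=; rewrite -(key_depicts Pp).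
  case: ltnP => // lt4 _ _ leT; have := leT k.
  by case: eqP lt4 => [->|]; lia.
case: ifP => // ok_m ok_ms; case: ltnP => // lt4 rare leT.
rewrite addnA -multiplicity_insert.
have [_ Pp'] := depicts_make Pp ok_m.
apply: (IH (insert T (key P)) _ _ Pp') => // k'.
by rewrite multiplicity_insert; have := leT k'; case: eqP lt4 => [->|]; lia.
Qed.

Lemma same_position_key p q : same_position p q -> key_at q = key_at p.
Proof. by case/and4P=> /eqP et /eqP eb _ _; rewrite /key_at et eb. Qed.

Lemma never_fifth_not_fivefold ms : plain_line initial_diagram ms ->
  never_fifth Leaf initial_diagram ms -> ~~ fivefold_repetition ms.
Proof.
move=> ok rare; rewrite /fivefold_repetition.
have le4 p : count (same_position p) (history ms) <= 4.
  apply: leq_trans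
    (never_fifth_count (key_at p) depicts_initial ok rare (fun _ => isT)).
  by rewrite add0n; apply: sub_count => q /same_position_key->.
rewrite (eq_has (a2 := pred0)) ?has_pred0 // => p.
by rewrite ltnNge le4.
Qed.

Lemma never_fifth_cat T P ms1 ms2 :
  never_fifth T P (ms1 ++ ms2) -> never_fifth T P ms1.
Proof.
elim: ms1 T P => [|m ms1 IH] T P /=; last by case: ifP => // _ /IH.
by case: ms2 => [|m ms2] /=; case: ifP.
Qed.

Definition lone_king_mated (P : diagram) :=
  let: (c, g) := P in
  all (fun s => if lookup g s is Some (c', k) then
     if same_color c' c then
       [&& k == King, s != king_home c &
         all (fun t => if maxn (dfile s t) (drank s t) == 1 then
           grid_in_check (grid_move g c King (s, t, None)) c else true) squares]
     else true else true) squares && grid_in_check g c.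

Lemma lone_king_mated_checkmate P p :
  depicts P p -> lone_king_mated P -> checkmate p.
Proof.
case: P => c g [pc gb ds] /andP[/allP mate check]; rewrite /= in pc gb.
apply/andP; split; last by rewrite pc -(grid_in_checkE gb).
apply/forallP=> -[[s t] q].
rewrite /legal /possible /pseudo_legal /make /src /dst /= gb pc.
have := mate s (mem_squares s); case gs: lookup => [[c' k]|] //.
rewrite same_colorE; case: eqP => // -> /and3P[/eqP-> s_home /allP mates].
apply/negP => /andP[/and5P[_ _ _ ok_q ok_m]].
have {ok_m} ok_m : maxn (dfile s t) (drank s t) == 1.
  case/orP: ok_m => // /existsP[d /and3P[s_home' _]].
  by rewrite s_home' in s_home.
have {ok_q} -> : q = None by apply/eqP.
rewrite /moved_board (negPf s_home) andbF en_passant_none // /src /dst /=.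
have := mates t (mem_squares t); rewrite ok_m => check_t.
rewrite -(@grid_in_checkE (grid_move g c King (s, t, None))) ?check_t // => u.
by rewrite !ffunE !lookup_store gb.
Qed.

(** All that must be computed about a game [ms.1 ++ ms.2] that ends with a lull
    [ms.2] of 150 plies; [mate] starts before its last ply and shows that no
    position before was dead. *)
Definition certificate (ms : seq move * seq move) (mate : seq move) :=
  let: (ms1, ms2) := ms in
  let P := play_diagram initial_diagram ms1 in
  let ms3 := take 149 ms2 in let Q := play_diagram P ms3 in
  [&& size ms2 == 150, plain_line initial_diagram ms1, plain_line P ms2,
      grid_quiet_line P ms2, plain_line Q mate,
      lone_king_mated (play_diagram Q mate),
      short_lulls 0 initial_diagram (ms1 ++ ms3) &
      never_fifth Leaf initial_diagram (ms1 ++ ms3)].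

Lemma complete_game_of_certificate ms1 ms2 mate :
  certificate (ms1, ms2) mate -> complete_game (ms1 ++ ms2).
Proof.
case/and5P=> /eqP size2 ok1 ok2 quiet2 /and4P[ok_mate mated short rare].
set ms3 := take _ ms2 in ok_mate mated short rare.
have e2 : ms2 = ms3 ++ drop 149 ms2 by rewrite cat_take_drop.
have size3 : size ms3 = 149 by rewrite size_take size2.
have ok_ms : plain_line initial_diagram (ms1 ++ ms2) by rewrite plain_line_cat ok1.
have ok13 : plain_line initial_diagram (ms1 ++ ms3).
  by move: ok_ms; rewrite e2 catA plain_line_cat => /andP[].
split; last first.
  apply: Or33; exists ms1, ms2, [::]; rewrite cats0; split=> //.
  by rewrite -(grid_quiet_lineE (depicts_play depicts_initial ok1) ok2).
split; first exact: depicts_line depicts_initial ok_ms.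
move=> n; rewrite size_cat size2 => lt_n.
have take_n : take n (ms1 ++ ms2) = take n (ms1 ++ ms3).
  by rewrite e2 catA takel_cat // size_cat size3 -ltnS -addnS.
have cat13 : ms1 ++ ms3 = take n (ms1 ++ ms2) ++ drop n (ms1 ++ ms3).
  by rewrite take_n cat_take_drop.
have ok_n : plain_line initial_diagram (take n (ms1 ++ ms2)).
  by move: ok13; rewrite cat13 plain_line_cat => /andP[].
have has_move : ~~ no_legal_move (play initial (take n (ms1 ++ ms2))).
  apply/forallPn; have := depicts_line depicts_initial ok_ms.
  rewrite -{1}(cat_take_drop n (ms1 ++ ms2)) legal_line_cat => /andP[_].
  case e: (drop n (ms1 ++ ms2)) => [|m l] /=.
    move: (congr1 size e); rewrite size_drop size_cat size2 => /eqP.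
    by rewrite subn_eq0 leqNgt lt_n.
  by case/andP=> m_legal _; exists m; rewrite negbK.
case=> [[]||].
- by case/andP => no_move _; rewrite no_move in has_move.
- by case/andP => no_move _; rewrite no_move in has_move.
- apply; exists (drop n (ms1 ++ ms3) ++ mate).
  have ok_all : plain_line initial_diagram
      (take n (ms1 ++ ms2) ++ drop n (ms1 ++ ms3) ++ mate).
    by rewrite catA -cat13 plain_line_cat ok13 /play_diagram foldl_cat.
  split.
    have := depicts_line depicts_initial ok_all.
    by rewrite legal_line_cat => /andP[].
  rewrite /play -foldl_cat.
  apply: (lone_king_mated_checkmate (depicts_play depicts_initial ok_all)).
  by rewrite catA -cat13 /play_diagram !foldl_cat.
- apply/negP; apply: never_fifth_not_fivefold ok_n _.
  by apply: (@never_fifth_cat _ _ _ (drop n (ms1 ++ ms3))); rewrite -cat13.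
- apply: short_lulls_not_seventy_five ok_n _.
  by move: short; rewrite cat13 => /short_lulls_cat[].
Qed.

(** * A game of 17697 plies *)

Definition coordinate (a : ascii) : 'I_8 :=
  match a with
  | "a" | "1" => @Ordinal 8 0 isT
  | "b" | "2" => @Ordinal 8 1 isT
  | "c" | "3" => @Ordinal 8 2 isT
  | "d" | "4" => @Ordinal 8 3 isT
  | "e" | "5" => @Ordinal 8 4 isT
  | "f" | "6" => @Ordinal 8 5 isT
  | "g" | "7" => @Ordinal 8 6 isT
  | _ => @Ordinal 8 7 isT
  end%char.

Definition promotion_letter (a : ascii) : option kind :=
  match a with
  | "N" => Some Knight
  | "B" => Some Bishop
  | "R" => Some Rook
  | "Q" => Some Queen
  | _ => None
  end%char.

(* The character after a move is either the letter of a promotion, which ends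
   the text, or a blank. *)
Fixpoint parse (s : string) : seq move :=
  match s with
  | String x (String y (String x' (String y' s1))) =>
    let st := ((coordinate x, coordinate y), (coordinate x', coordinate y')) in
    match s1 with
    | String a s2 => (st, promotion_letter a) :: parse s2
    | EmptyString => [:: (st, None)]
    end
  | _ => [::]
  end.

(** The plies up to an event, and the event. Meanwhile each side plays some moves
    once and then repeats a cycle; an empty cycle stands for the one the side is
    in already. *)
Record stage := Stage {
  white_once : string; white_cycle : string;
  black_once : string; black_cycle : string;
  event : string
}.

Definition keep := Stage "" "" "" "".
Definition replan_white once cycle := Stage once cycle "" "".
Definition replan_black once cycle := Stage "" "" once cycle.
Definition replan := Stage.

Definition plan := (seq move * seq move)%type.

Definition revise (once cycle : string) (p : plan) : plan :=
  (parse once, if parse cycle is m :: l then m :: l else p.2).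

Definition null_move : move := ((ord0, ord0), (ord0, ord0), None).

Definition next_move (p : plan) : move * plan :=
  match p with
  | (m :: ms, l) => (m, (ms, l))
  | ([::], m :: l) => (m, ([::], rcons l m))
  | _ => (null_move, p)
  end.

Fixpoint interleave n c (w b : plan) : seq move * plan * plan :=
  if n is n'.+1 then
    if c is White then
      let: (m, w1) := next_move w in
      let: (ms, w2, b2) := interleave n' Black w1 b in (m :: ms, w2, b2)
    else
      let: (m, b1) := next_move b in
      let: (ms, w2, b2) := interleave n' White w b1 in (m :: ms, w2, b2)
  else ([::], w, b).

(** The plies up to the last event, and the lull after it. [last] is the player
    of the previous event, with the start as an event of Black. *)
Fixpoint unfold_score (last : color) (w b : plan) (sts : seq (color * stage)) :
    seq move * seq move :=
  if sts is (c, st) :: sts' then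
    let n := if same_color c last then 149 else 148 in
    let: (ms, w', b') := interleave n (opp last)
       (revise (white_once st) (white_cycle st) w)
       (revise (black_once st) (black_cycle st) b) in
    let: (ms1, ms2) := unfold_score c w' b' sts' in
    (ms ++ parse (event st) ++ ms1, ms2)
  else ([::], (interleave 150 (opp last) w b).1.1).

Local Open Scope string_scope.

(** Black takes the two knights, the only white pieces that can come out while
    the white pawns stand still, with the c- and f-pawns: these two files are
    then free of black pawns, and the b- and g-files hold two each. *)
Definition opening_captures : seq stage := [::
  replan
    "" "b1a3 a3b5 b5d4 d4c6 c6a5 a5c4 c4e3 e3d5 d5c3 c3b1"
    "" "g8h6 b8a6 h6g8 a6b8" "b7b6";
  keep "b6b5";
  replan
    "" "b1c3 g1f3 c3b1 f3g1"
    "" "g8h6 h6f5 f5e3 e3c4 c4a5 a5b7 b7d6 d6e4 e4f6 f6g8" "g7g6";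
  keep "g6g5";
  replan_white "f3e5 e5c4 c4b6" "h1g1 c3d5 g1h1 d5c3" "c7b6";
  replan_white "c3d5 d5f4 f4g6" "h1g1 a1b1 g1h1 b1a1" "f7g6"].

(** The c- and f-pawns walk through. The b- and d-pawns take into the open
    c-file, the e- and g-pawns into the open f-file, and the a- and h-pawns take
    on b7 and g7, behind the doubled black pawns. *)
Definition white_pawns : seq stage := [::
  keep "c2c3"; keep "c3c4";
  replan
    "" "d1a4 a4c2 c2c3 c3b3 b3d1" "" "a5b7 b7d6 d6f7 f7e5 e5c6 c6a5" "c4c5";
  keep "c5c6";
  replan_black "" "d8c7 h8g8 c7d8 g8h8" "c6c7";
  replan_black "c8b7" "b8a6 a6b4 b4c6 c6b8" "c7c8B";
  keep "b2b3";
  replan "d1c2" "c1a3 h1g1 a3c1 g1h1" "" "b7c6 c6d5 d5f3 f3e4 e4b7" "b3b4";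
  replan_black "g8g7 g7f7 f7f5 f5c5" "" "b4c5";
  replan_black "c6d5 e8f7 f7f6 f6e5 e5d4" "d5g8 g8b3 b3e6 e6f7 f7d5" "c5c6";
  keep "c6c7";
  replan_white "c8b7" "" "c7c8N";
  keep "d2d3";
  replan "e1d2" "c8d6 b7c6 d6c8 c6b7" "d4e5" "" "d3d4";
  replan_black "e5f6" "" "d4d5";
  replan
    "c6b7" "a1b1 d2d1 b1a1 d1d2"
    "a6b8 b8c6" "e6h3 h3f5 f5e4 e4f3 f3h5 h5g4 g4e6" "d5c6";
  keep "c6c7";
  replan_white "c8d6" "" "c7c8N";
  replan_black "" "g4f3 f3e4 e4d3 d3c4 c4b3 b3e6 e6g4" "f2f3";
  replan_black "" "b3c4 c4g8 g8d5 d5e4 e4f5 f5h3 h3g4 g4e6 e6b3" "f3f4";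
  keep "f4f5";
  replan_black "f6e5" "d8e8 e8f7 f7f6 f6g7 g7g8 g8b3 b3c4 c4c7 c7d8" "f5f6";
  replan_black "f7b3" "h3f5 f5e4 e4f3 f3g4 g4h3" "f6f7";
  replan_black "f8h6" "" "f7f8R";
  replan_white "" "c2b1 f8e8 b1c2 e8f8" "e2e3";
  keep "e3e4";
  replan_black "e5d4" "f3e2 e2c4 c4e6 e6g4 g4f3" "e4e5";
  replan_black "a5c6 c6b4 b4d5 d5f6" "" "e5f6";
  keep "f6f7";
  replan_white "" "d6e4 e8g8 e4d6 g8e8" "f7f8N";
  replan_white "" "c8d6 g1h1 d6c8 h1g1" "g2g3";
  keep "g3g4";
  replan
    "" "g1g2 b1d1 g2g1 d1b1" "f3e2 e2c4 c4e6 e6f5" "b3g3 g3e5 e5g7 g7f7 f7b3"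
    "g4f5";
  keep "f5f6";
  replan
    "g1h1" "f1e2 e2h5 h5d1 d1a4 a4b3 b3f7 f7c4 c4d3 d3f1"
    "" "h6g7 d4e5 g7h6 e5d4" "f6f7";
  replan
    "f8e6 b1b3" "e2h5 h5g4 g4f3 f3g2 g2h3 h3f1 f1e2" "" "a8b8 h6g7 b8a8 g7h6"
    "f7f8R";
  replan_white "a3c1" "" "a2a3";
  keep "a3a4"; keep "a4a5"; keep "a5a6";
  replan "b7d5" "" "a8b8 b8b7" "g7f6 f6h8 h8g7" "a6b7";
  keep "b7b8N"; keep "h2h3";
  replan
    "" "b3a4 a4b4 b4b1 b1d3 d3c2 c2c4 c4b3" "" "g3g4 g4f3 f3g2 g2g3" "h3h4";
  keep "h4h5"; keep "h5h6";
  replan_black "f6g7" "" "h6g7";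
  replan_white "g8h8" "" "g7g8N"].

(** With the white pawns gone all black pawns walk through, and Black then
    takes everything but the king and the queen. *)
Definition black_pawns_and_captures : seq stage := [::
  replan
    "" "a1a5 a5a2 a2a4 a4a1" "" "f3g2 g2f1 f1f7 f7e8 e8d8 d8c7 c7c5 c5f2 f2f3"
    "b5b4";
  keep "b4b3"; keep "b3b2"; keep "b2b1R"; keep "b6b5"; keep "b5b4";
  keep "b4b3"; keep "b3b2";
  replan "" "a4a6 a6a5 a5a2 a2a3 a3a4" "b1a1" "" "b2b1R";
  keep "a7a6";
  replan
    "" "e6f4 f4h5 h5g7 g7e6" "" "a1a2 a2b2 b2b3 b3h3 h3c3 c3a3 a3a1" "a6a5";
  replan_white "a4d4" "" "a5a4";
  keep "a4a3";
  replan
    "" "c8b6 b6a8 a8c7 c7e8 e8g7 g7f5 f5d6 d6c8"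
    "" "c3h3 h3h5 h5h4 h4g4 g4g3 g3c3" "a3a2";
  keep "a2a1N"; keep "d7d6";
  replan_white "d5c6" "c2d1 d1b3 b3c4 c4a2 a2a7 a7a3 a3b2 b2c2" "d6d5";
  replan
    "d4a4" "c6b7 b7a6 a6d3 d3c4 c4b5 b5e8 e8c6"
    "" "h5h4 h4g4 g4f4 f4f3 f3h3 h3h5" "d5d4";
  keep "d4d3";
  replan
    "d2c3" "a6c8 c8b7 b7c6 c6d7 d7e8 e8b5 b5c4 c4a6"
    "b1b2" "f3f1 f1f2 f2f6 f6f5 f5f3" "d3d2";
  replan_black "" "g2h2 h2f2 f2g2" "d2d1B";
  replan_white "e6c5" "" "e7e6";
  replan_black "e5f5" "" "e6e5";
  replan_white "e4d2" "b8c6 c6a5 a5c4 c4a3 a3b5 b5c7 c7a6 a6b8" "e5e4";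
  keep "e4e3";
  replan_white "e2h5" "" "e3e2";
  keep "e2e1B"; keep "g5g4"; keep "g4g3"; keep "g3g2";
  replan
    "" "b6d5 d5b4 b4c2 c2a3 a3b5 b5c7 c7a6 a6b8 b8d7 d7b6"
    "" "e1f2 f2g3 g3h4 h4e1" "g2g1R";
  keep "g6g5"; keep "g5g4";
  replan_black "g3f4" "b2b1 g1f1 b1b2 f1g1" "g4g3";
  keep "g3g2";
  replan "d2b1" "" "" "d1e2 b2d2 e2d1 d2b2" "g2g1B";
  replan_black "" "g1f2 f6f7 f2g1 f7f6" "h7h6";
  replan_white "h5f3" "" "h6h5";
  keep "h5h4"; keep "h4h3";
  replan_black "h2g3" "" "h3h2";
  replan "h1g1" "" "" "e2d1 f4d6 d1e2 d6f4" "h2h1B";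
  replan_white "" "b3a2 a2a3 a3b2 b2b5 b5b3" "h1f3";
  keep "f6f8";
  replan_black "" "f1e1 g3h2 e1f1 h2g3" "f3b7";
  replan_black "d1c2" "f8c8 c8a8 a8d8 d8d7 d7f7 f7f8" "c2b1";
  keep "f2g1"; keep "b7a6"; keep "g1c5";
  replan_black "" "e1e8 e8e2 e2e7 e7e1" "a6c4";
  replan_black "h2g1" "" "g1g8";
  replan_black "d2h2" "" "h2h8";
  replan_black "g8e8" "e1h1 c8c6 h1e1 c6c8" "e8a4";
  replan_black "d6f4" "" "f4c1"].

(** White takes everything but the king; the queen that is left keeps the
    position alive for the closing lull. *)
Definition white_captures : seq stage := [::
  replan_black "" "c1g5 a4a8 g5c1 a8a4" "c3c4";
  replan
    "" "b5b7 b7b3 b3b5"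
    "f5g4 g4h4 c6a6" "g5e3 e3c1 c1f4 f4g3 g3f2 f2d4 d4f6 f6g5" "c4c5";
  replan
    "b3b7 c5c4" "c4d4 d4c3 c3c4" "" "a6e6 e6f6 f6f8 f8f2 f2b2 b2a2 a2a6"
    "b7a8";
  keep "a8a1"; keep "a1b1";
  replan "b1h7" "" "h4g3" "" "h7h8";
  keep "h8h1";
  replan "h1f1" "" "" "g5d8 d8c7 c7f4 f4d6 d6e7 e7h4 h4g5" "f1f8";
  replan
    "" "c3b2 b2b3 b3c2 c2d1 d1e1 e1d2 d2d3 d3c3"
    "g3h2" "h2h3 h3g3 g3g2 g2g1 g1h2" "f8e7"].

Definition mating_line := parse "d1e1 g1h1 e1f1 h1h2 e7h4".

Local Close Scope string_scope.

Definition score : seq (color * stage) :=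
  [seq (Black, st) | st <- opening_captures] ++
  [seq (White, st) | st <- white_pawns] ++
  [seq (Black, st) | st <- black_pawns_and_captures] ++
  [seq (White, st) | st <- white_captures].

Definition longest : seq move * seq move :=
  unfold_score Black ([::], [::]) ([::], [::]) score.

Lemma longest_certified : certificate longest mating_line.
Proof. by vm_cast_no_check (erefl true). Qed.

Lemma size_longest : size (longest.1 ++ longest.2) = 17697.
Proof. by apply/eqP; vm_cast_no_check (erefl true). Qed.

Lemma complete_longest : complete_game (longest.1 ++ longest.2).
Proof.
have := longest_certified; case: longest => ms1 ms2.
exact: complete_game_of_certificate.
Qed.

Theorem theorem1p1 :
  (forall ms : seq move, game ms -> size ms <= 17697) /\
  (exists ms : seq move, complete_game ms /\ size ms = 17697).
Proof.
split; first exact: game_size.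
exists (longest.1 ++ longest.2).
by split; [apply: complete_longest|apply: size_longest].
Qed.
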